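(* Let $n\ge2$ and $k\ge2$, and let $\mathbb{Z}/k$ act on the Cuntz algebra $\mathcal{O}_n$ by the restriction of the gauge action. Then $\mathrm{dim}^{\mathbb{Z}/k}_{\mathrm{WLT}}(\mathcal{O}_n)\ge1$.
   Context: $\mathcal{O}_n$ is the universal $C^*$-algebra generated by $S_1,\ldots,S_n$ with $S_i^*S_i=1$ for all $i$ and $\sum_{i=1}^nS_iS_i^*=1$. The gauge action of $\mathbb{S}^1$ is $S_i\mapsto zS_i$ for $z\in\mathbb{S}^1$; $\mathbb{Z}/k$ is identified with the $k$th roots of unity. Weak local-triviality dimension: let a compact group $G$ act on a unital $C^*$-algebra $A$. Equip $C(G)$ with $(\alpha_gf)(h)=f(hg)$ and $C_0((0,1])\otimes C(G)$ with the action on the second factor, and let $t$ be the identity function in $C_0((0,1])$. $\mathrm{dim}^G_{\mathrm{WLT}}(A)$ is the smallest $m\ge0$ for which there exist $G$-equivariant $*$-homomorphisms $\rho_0,\ldots,\rho_m:C_0((0,1])\otimes C(G)\to A$ such that $\sum_{i=0}^m\rho_i(t\otimes1)$ is invertible ($\infty$ if no such $m$ exists). *)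

(* Defs.v *)
From HB Require Import structures.
From mathcomp Require Import all_boot all_order all_algebra all_fingroup.
From mathcomp Require Import complex.
From mathcomp Require Import all_classical all_reals all_analysis.

Set Implicit Arguments.
Unset Strict Implicit.
Unset Printing Implicit Defensive.

Import Order.TTheory GRing.Theory Num.Theory.
Import numFieldNormedType.Exports.

Local Open Scope classical_set_scope.
Local Open Scope ring_scope.
Local Open Scope complex_scope.

(* Unital complex C*-algebras.  The norm of a normed module over R[i] takes its
   values in R[i] (in fact in the nonnegative reals).  The multiplication is part
   of the mixin because Hierarchy Builder cannot declare a join of normed modules
   and rings after numDomainType; the MathComp algebra structure is recovered
   below.  MathComp algebras satisfy 1 != 0, so the zero algebra is excluded. *)
HB.mixin Record isCStarAlgebra (R : realType) A
    of CompleteNormedModule R[i] A := {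
  cstar_one : A;
  cstar_mul : A -> A -> A;
  star : A -> A;
  cstar_mulA : associative cstar_mul;
  cstar_mul1r : left_id cstar_one cstar_mul;
  cstar_mulr1 : right_id cstar_one cstar_mul;
  cstar_mulDl : left_distributive cstar_mul +%R;
  cstar_mulDr : right_distributive cstar_mul +%R;
  cstar_one_neq0 : cstar_one != 0;
  cstar_scaleAl : forall (z : R[i]) (a b : A),
    z *: cstar_mul a b = cstar_mul (z *: a) b;
  cstar_scaleAr : forall (z : R[i]) (a b : A),
    z *: cstar_mul a b = cstar_mul a (z *: b);
  starK : involutive star;
  starD : {morph star : a b / a + b};
  starZ : forall (z : R[i]) (a : A), star (z *: a) = z^* *: star a;
  starM : forall a b : A, star (cstar_mul a b) = cstar_mul (star b) (star a);
  norm_mul_le : forall a b : A, `|cstar_mul a b| <= `|a| * `|b|;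
  norm_star_mul : forall a : A, `|cstar_mul (star a) a| = `|a| ^+ 2
}.

#[short(type="cstarAlgType")]
HB.structure Definition CStarAlgebra (R : realType) :=
  {A of isCStarAlgebra R A & CompleteNormedModule R[i] A}.

Section CStarAlgebraRing.
Variables (R : realType) (A : cstarAlgType R).

HB.instance Definition _ := GRing.Zmodule_isNzRing.Build (CStarAlgebra.sort A)
  (@cstar_mulA R A) (@cstar_mul1r R A) (@cstar_mulr1 R A)
  (@cstar_mulDl R A) (@cstar_mulDr R A) (@cstar_one_neq0 R A).
HB.instance Definition _ := GRing.Lmodule_isLalgebra.Build R[i]
  (CStarAlgebra.sort A) (@cstar_scaleAl R A).
HB.instance Definition _ := GRing.Lalgebra_isAlgebra.Build R[i]
  (CStarAlgebra.sort A) (@cstar_scaleAr R A).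

End CStarAlgebraRing.

Section CuntzAlgebra.
Variable R : realType.

Definition star_preserving (A B : cstarAlgType R) (f : A -> B) : Prop :=
  forall a, f (star a) = star (f a).

Definition star_subalgebra (A : cstarAlgType R) (D : set A) : Prop :=
  [/\ D 1,
      forall a b, D a -> D b -> D (a + b),
      forall a b, D a -> D b -> D (a * b),
      forall (z : R[i]) a, D a -> D (z *: a)
    & forall a, D a -> D (star a)].

Definition cstar_generated (A : cstarAlgType R) (I : Type) (S : I -> A) : Prop :=
  forall D : set A, closed D -> star_subalgebra D -> (forall i, D (S i)) ->
  D = setT.

Definition cuntz_relations (A : cstarAlgType R) n (S : 'I_n -> A) : Prop :=
  (forall i, star (S i) * S i = 1) /\ \sum_(i < n) S i * star (S i) = 1.

(* (O, S) is the Cuntz algebra O_n with its canonical generators: the universal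
   C*-algebra generated by elements satisfying the Cuntz relations.  The
   *-homomorphism phi is unique because S generates O. *)
Definition is_cuntz_algebra (O : cstarAlgType R) n (S : 'I_n -> O) : Prop :=
  [/\ cuntz_relations S,
      cstar_generated S
    & forall (B : cstarAlgType R) (T : 'I_n -> B), cuntz_relations T ->
        exists phi : {lrmorphism O -> B},
          star_preserving phi /\ forall i, phi (S i) = T i].

(* The values of gamma off the unit circle are irrelevant.  When S generates O
   these conditions determine gamma on the circle, and make it a group action
   there. *)
Definition is_gauge_action (O : cstarAlgType R) n (S : 'I_n -> O)
    (gamma : R[i] -> {lrmorphism O -> O}) : Prop :=
  forall z : R[i], `|z| = 1 ->
    star_preserving (gamma z) /\ forall i, gamma z (S i) = z *: S i.

End CuntzAlgebra.

Section WeakLocalTriviality.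
Variable R : realType.

Definition halfopen01 : set R := `]0, 1]%classic.

(* C_0((0,1]): a function on (0,1] is encoded by its extension by 0 to R, so
   that equality, sup norm and algebraic operations are those of functions on
   (0,1]. *)
Definition C0_halfopen01 : set (R -> R[i]^o) :=
  [set f | [/\ {within halfopen01, continuous f},
               f x @[x --> (0 : R)^'+] --> (0 : R[i]^o)
             & forall x, ~ halfopen01 x -> f x = 0]].

Definition id_halfopen01 : R -> R[i]^o := (fun x => x%:C : R[i]^o) \_ halfopen01.

(* For a finite (discrete) group G, C(G) consists of all functions G -> R[i]. *)
Section FiniteGroup.
Variable G : finGroupType.

Definition elem_tensor (f : R -> R[i]^o) (u : G -> R[i]^o) : R * G -> R[i]^o :=
  fun p => f p.1 * u p.2.

Definition alg_tensor : set (R * G -> R[i]^o) :=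
  [set F | exists m (f : 'I_m -> R -> R[i]^o) (u : 'I_m -> G -> R[i]^o),
     (forall i, C0_halfopen01 (f i)) /\ F = \sum_(i < m) elem_tensor (f i) (u i)].

(* The C*-algebra C_0((0,1]) (x) C(G), realised inside the bounded functions on
   (0,1] x G: the closure in the sup norm of the span of elementary tensors. *)
Definition cone_tensor : set (R * G -> R[i]^o) :=
  [set F | forall e : R, 0 < e ->
     exists2 F', alg_tensor F' & forall p, `|F p - F' p| <= e%:C].

Definition translate (g : G) (F : R * G -> R[i]^o) : R * G -> R[i]^o :=
  fun p => F (p.1, (p.2 * g)%g).

Variable A : cstarAlgType R.

(* rho restricted to cone_tensor is a (not necessarily unital) *-homomorphism
   to A; its values outside cone_tensor are irrelevant. *)
Definition cone_star_hom (rho : (R * G -> R[i]^o) -> A) : Prop :=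
  [/\ {in cone_tensor &, forall E F, rho (E + F) = rho E + rho F},
      forall z : R[i], {in cone_tensor, forall F, rho (z *: F) = z *: rho F},
      {in cone_tensor &, forall E F, rho (E * F) = rho E * rho F}
    & {in cone_tensor, forall F, rho (fun p => (F p)^*) = star (rho F)}].

Definition cone_equivariant (alpha : G -> A -> A)
    (rho : (R * G -> R[i]^o) -> A) : Prop :=
  forall g, {in cone_tensor, forall F, rho (translate g F) = alpha g (rho F)}.

Definition invertible (a : A) : Prop := exists b, b * a = 1 /\ a * b = 1.

Definition wlt_witness (alpha : G -> A -> A) (m : nat) : Prop :=
  exists rho : 'I_m.+1 -> (R * G -> R[i]^o) -> A,
    (forall i, cone_star_hom (rho i) /\ cone_equivariant alpha (rho i)) /\
    invertible (\sum_(i < m.+1) rho i (elem_tensor id_halfopen01 (fun=> 1))).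

Definition wlt_dim (alpha : G -> A -> A) : \bar R :=
  match pselect (exists m, `[< wlt_witness alpha m >]) with
  | left ex_m => ((ex_minn ex_m)%:R)%:E
  | right _ => +oo%E
  end.

End FiniteGroup.
End WeakLocalTriviality.

(* Main.v *)
Require Import Defs.
From HB Require Import structures.
From mathcomp Require Import all_boot all_order all_algebra all_fingroup.
From mathcomp Require Import all_solvable all_field.
From mathcomp Require Import complex ring lra zify.
From mathcomp Require Import all_classical all_reals all_analysis.

Set Implicit Arguments.
Unset Strict Implicit.
Unset Printing Implicit Defensive.

Import Order.TTheory GRing.Theory Num.Theory.
Import numFieldNormedType.Exports.

Local Open Scope classical_set_scope.
Local Open Scope ring_scope.
Local Open Scope complex_scope.

(* A witness in dimension 0 yields an invertible v with gamma_zeta(v) = zeta v.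
   Such a v cannot exist: this is an index obstruction, read off on the full
   Fock space of C^n instead of in K-theory.  Approximate v by a *-polynomial p
   in the generators, all of whose monomials have degree 1 mod k, and let p act
   by creation and annihilation operators.  Averaging over the gauge action
   shows that a *-polynomial acts on vectors far from the vacuum with norm at
   most its norm in O_n; hence p is Fredholm from the sector F_0 to the sector
   F_1, where F_j is the l^2 space of words of length j mod k.  Splitting off
   the last k letters gives F_0 = C + F_0^N and F_1 = C^n + F_1^N with N = n^k,
   and p respects these decompositions up to finite rank.  Its index a thus
   satisfies a = N a + 1 - n, impossible as 0 < n - 1 < N - 1. *)

(** * The index of a Fredholm map *)

(** The element [v] is the image of [t] tensored with the inclusion character of Z/k into the
    circle, and the conjugate character provides its inverse. The creation operators satisfy only
    the Toeplitz relations: their range projections sum to 1 minus the vacuum projection. So the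
    Cuntz algebra does not act on the Fock space and [v] cannot be transported there. Only formal
    polynomials act, and the algebra norm controls them only away from the vacuum; an inverse
    survives modulo finite-dimensional parts, which is why an index appears. The last letters are
    split off, not the first, because the generators act at the front of a word. Removing [k] of
    them preserves the length mod [k], so each sector reproduces itself, apart from its words
    shorter than [k]. The index is not computed from kernels and cokernels. The map is completed to
    a bijection by finite-dimensional spaces on both sides, and the difference of their dimensions
    is stable under finite-rank changes. This part is pure linear algebra; analysis enters through
    the norm bound on polynomials and the Neumann series that makes the map Fredholm. *)

Section LinearFunctions.
Variable K : fieldType.

Section Maps.
Variables U V W : lmodType K.

Definition linear_pack (f : U -> V) (lf : linear f) : {linear U -> V} :=
  HB.pack f (GRing.isLinear.Build K U V *:%R f lf).

Lemma linear_fun0 (f : U -> V) : linear f -> f 0 = 0.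
Proof. by move=> lf; rewrite -[f]/(linear_pack lf : _ -> _) linear0. Qed.

Lemma linear_funD (f : U -> V) : linear f -> {morph f : x y / x + y}.
Proof. by move=> lf; rewrite -[f]/(linear_pack lf : _ -> _);
  apply: linearD. Qed.

Lemma linear_funN (f : U -> V) : linear f -> {morph f : x / - x}.
Proof. by move=> lf; rewrite -[f]/(linear_pack lf : _ -> _);
  apply: linearN. Qed.

Lemma linear_funB (f : U -> V) : linear f -> {morph f : x y / x - y}.
Proof. by move=> lf; rewrite -[f]/(linear_pack lf : _ -> _);
  apply: linearB. Qed.

Lemma linear_funZ (f : U -> V) : linear f -> forall a, {morph f : x / a *: x}.
Proof. by move=> lf; rewrite -[f]/(linear_pack lf : _ -> _);
  apply: linearZZ. Qed.

Lemma linear_can (f : U -> V) (g : V -> U) :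
  linear f -> cancel f g -> cancel g f -> linear g.
Proof. by move=> lf fK gK a u v; rewrite -{1}[u]gK -{1}[v]gK -lf fK. Qed.

Lemma linear_inj (f : U -> V) : linear f -> (forall v, f v = 0 -> v = 0) ->
  injective f.
Proof.
move=> lf f0 u v fuv; apply/eqP; rewrite -subr_eq0; apply/eqP/f0.
by rewrite linear_funB // fuv subrr.
Qed.

End Maps.

Lemma linear_kernel (E F : vectType K) (f : E -> F) : linear f ->
  (dim F < dim E)%N -> exists2 x, x <> 0 & f x = 0.
Proof.
move=> lf dFE; pose g := linfun (linear_pack lf).
have : lker g != 0%VS.
  apply/eqP => kg0; have := limg_ker_dim g fullv.
  rewrite kg0 capv0 dimv0 add0n dimvf => dg.
  have := dimvS (subvf (limg g)); rewrite dg dimvf leqNgt dFE //.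
move=> kg; exists (vpick (lker g)); first by apply/eqP; rewrite vpick0.
by have := memv_pick (lker g); rewrite memv_ker lfunE /= => /eqP.
Qed.

Definition finite_rank (V W : lmodType K) (T : V -> W) :=
  exists (F : vectType K) (phi : V -> F) (e : F -> W),
    [/\ linear phi, linear e & forall v, T v = e (phi v)].

(** A kernel vector of [H] can be sought in a finite-dimensional space: the [V]-corner of [H] is the
    identity plus a map through [F], so the [V]-component is determined by its image in [F] and by
    the [E]-component. If [dim E' < dim E], counting dimensions gives a nonzero one. *)
Lemma dim_le_of_inj (V : lmodType K) (E E' : vectType K)
    (H : V * E -> V * E') :
  linear H -> injective H ->
  finite_rank (fun v => (H (v, 0)).1 - v) -> (dim E <= dim E')%N.
Proof.
move=> lH iH [F [phi [e [lphi le HF]]]]; rewrite leqNgt; apply/negP => dE.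
pose e' (p : F * E) : V := e p.1 + (H (0, p.2)).1.
pose phi' (p : V * E) : F * E := (phi p.1, p.2).
(* With [v = e' (c, y)], the equation [M ((c, y), x) = 0] says [(c, y) = - phi' (v, x)] and that the
   [E']-component of [H (v, x)] is 0; together they give [H (v, x) = 0]. *)
pose M (q : (F * E) * E) : (F * E) * E' :=
  (q.1 + phi' (e' q.1, q.2), (H (e' q.1, q.2)).2).
have Z2 a (u v : E) : (0 : V, a *: u + v) = a *: (0, u) + (0, v).
  by congr pair; rewrite /= scaler0 addr0.
have le' : linear e'.
  move=> a [c y] [c' y'] /=; rewrite /e' /= le Z2 lH /=. rewrite (scalerDr a (e
    c)).
  by rewrite addrACA.
have lphi' : linear phi' by move=> a [v x] [v' x']; rewrite /phi' /= lphi.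
have l1 : linear (fun q : (F * E) * E => (e' q.1, q.2)).
  by move=> a [? ?] [? ?] /=; rewrite le'.
have lM : linear M.
  move=> a q q'; rewrite /M l1 lphi' lH /=; congr pair.
  by rewrite /= (scalerDr a q.1) addrACA.
have dM : (dim ((F * E) * E')%type < dim ((F * E) * E)%type)%N.
  by rewrite /dim /= ltn_add2l.
have [[[c y] x] nz [Mc My Mx]] := linear_kernel lM dM.
move: Mc My Mx => /= Mc My Mx.
have Hsplit v z : (H (v, z)).1 = v + e' (phi' (v, z)).
  have -> : (v, z) = (v, 0) + (0, z) by congr pair; rewrite /= ?addr0 ?add0r.
  rewrite (linear_funD lH) /= /e' /phi' /= addr0 add0r addrA -HF.
  by rewrite [v + _]addrC subrK.
have He : (e' (c, y), x) = 0.
  apply: iH; rewrite linear_fun0 //; apply/eqP.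
  rewrite [H _]surjective_pairing xpair_eqE /= Mx eqxx andbT Hsplit.
  have {1}-> : (c, y) = - phi' (e' (c, y), x).
    by apply/eqP; rewrite -addr_eq0 xpair_eqE /= Mc My !eqxx.
  by rewrite linear_funN // addNr.
case: He => e0 x0; move: Mc My; rewrite e0 x0 linear_fun0 // !addr0 => c0 y0.
by apply: nz; rewrite c0 y0 x0.
Qed.

Lemma linear_pairl (U V : lmodType K) : linear (fun v : U => (v, 0 : V)).
Proof. by move=> a u v; congr pair; rewrite /= scaler0 addr0. Qed.

Lemma linear_pairr (U V : lmodType K) : linear (fun v : V => (0 : U, v)).
Proof. by move=> a u v; congr pair; rewrite /= scaler0 addr0. Qed.

Section FiniteRank.
Variables U V W X : lmodType K.

Lemma finite_rank_comp (f : U -> V) (T : V -> W) (g : W -> X) :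
  linear f -> linear g -> finite_rank T -> finite_rank (fun u => g (T (f u))).
Proof.
move=> lf lg [F [phi [e [lphi le TE]]]].
exists F, (phi \o f), (g \o e); split => [a u v|a u v|u] /=.
- by rewrite lf lphi.
- by rewrite le lg.
- by rewrite TE.
Qed.

Lemma finite_rankB (S T : V -> W) :
  finite_rank S -> finite_rank T -> finite_rank (fun v => S v - T v).
Proof.
move=> [F [phi [e [lphi le SE]]]] [F' [phi' [e' [lphi' le' TE]]]].
exists (F * F')%type, (fun v => (phi v, phi' v)), (fun x => e x.1 - e' x.2).
split => [a u v|a u v|v] /=.
- by rewrite lphi lphi'.
- by rewrite le le' opprD scalerBr addrACA.
- by rewrite SE TE.
Qed.

End FiniteRank.

(* A completion of [f v := (G (v, 0)).1] to a bijection (a Grushin problem); the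
   index of [f] is [dim E' - dim E]. *)
Definition grushin (V W : lmodType K) (E E' : vectType K)
    (G : V * E -> W * E') := linear G /\ bijective G.

Lemma grushin_le (V W : lmodType K) (E1 E1' E2 E2' : vectType K)
    (G1 : V * E1 -> W * E1') (G2 : V * E2 -> W * E2') :
  grushin G1 -> grushin G2 ->
  finite_rank (fun v => (G1 (v, 0)).1 - (G2 (v, 0)).1) ->
  (dim E1 + dim E2' <= dim E2 + dim E1')%N.
Proof.
move=> [l1 b1] [l2 [G2' K2 K2']] fr.
have l2' := linear_can l2 K2 K2'.
pose H (p : V * (E1 * E2')) : V * (E2 * E1') :=
  let wz := G1 (p.1, p.2.1) in let vx := G2' (wz.1, p.2.2) in
  (vx.1, (vx.2, wz.2)).
apply: (@dim_le_of_inj V (E1 * E2')%type (E2 * E1')%type H).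
- move=> a p q; rewrite /H /=.
  have -> : (a *: p.1 + q.1, a *: p.2.1 + q.2.1) =
    a *: (p.1, p.2.1) + (q.1, q.2.1) by [].
  rewrite l1 /=.
  set u := G1 _; set u' := G1 _.
  have -> : (a *: u.1 + u'.1, a *: p.2.2 + q.2.2) =
    a *: (u.1, p.2.2) + (u'.1, q.2.2) by [].
  by rewrite l2'.
- move=> [v [x y]] [v' [x' y']]; rewrite /H /= => -[e1 e2 e3].
  set u := G1 _ in e1 e2 e3; set u' := G1 _ in e1 e2 e3.
  have : G2' (u.1, y) = G2' (u'.1, y').
    by rewrite [LHS]surjective_pairing e1 e2 -surjective_pairing.
  move=> /(can_inj K2') [e4 ->].
  have : G1 (v, x) = G1 (v', x').
    by rewrite [LHS]surjective_pairing [RHS]surjective_pairing e4 e3.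
  by move=> /(bij_inj b1) [-> ->].
- pose T v := (G2' ((G1 (v, 0)).1 - (G2 (v, 0)).1, 0)).1 -
              (G2' (0, (G2 (v, 0)).2)).1.
  have HT v : (H (v, 0)).1 - v = T v.
    rewrite /H /T /=.
    have -> : ((G1 (v, 0)).1, 0 : E2') =
      ((G1 (v, 0)).1 - (G2 (v, 0)).1, 0) + (G2 (v, 0) - (0, (G2 (v, 0)).2)).
      congr pair => /=; first by rewrite subr0 subrK.
      by rewrite subrr addr0.
    by rewrite (linear_funD l2') (linear_funB l2') K2 /= -addrA addrAC subrr
      add0r.
  suff : finite_rank T.
    by move=> [F [phi [e [? ? TE]]]]; exists F, phi, e; split=> // v;
      rewrite HT.
  apply: finite_rankB.
    apply: (@finite_rank_comp V V W V id
      (fun v => (G1 (v, 0)).1 - (G2 (v, 0)).1) (fun w => (G2' (w, 0)).1)) => //.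
    by move=> a u w /=; rewrite linear_pairl l2'.
  exists E2', (fun v => (G2 (v, 0)).2), (fun z => (G2' (0, z)).1); split=> //.
    by move=> a u w /=; rewrite linear_pairl l2.
  by move=> a u w /=; rewrite linear_pairr l2'.
Qed.

(** The pair [(f, phi)] is injective with range of finite codimension in [W * F]. Adding the least
    number [b] of vectors that makes it surjective also makes it injective, since a relation would
    allow one of them to be dropped. *)
Lemma grushin_exists (V W : lmodType K) (f : V -> W) (F F' : vectType K)
    (phi : V -> F) (e : F' -> W) :
  linear f -> linear phi -> linear e ->
  (forall v, f v = 0 -> phi v = 0 -> v = 0) ->
  (forall w, exists v x, w = f v + e x) ->
  exists (b : nat) (G : V * 'rV[K]_b -> W * F),
    grushin G /\ forall v, (G (v, 0)).1 = f v.
Proof.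
move=> lf lphi le inj_f surj_f.
pose f1 v := (f v, phi v).
have lf1 : linear f1 by move=> a u v; rewrite /f1 lf lphi.
pose good b := exists s : 'rV[K]_b -> W * F, linear s /\
  forall t, exists v x, t = f1 v + s x.
have ex_good : exists b, `[<good b>].
  pose B := vbasis {: (F' * F)%type}.
  pose dec (r : 'rV[K]_(\dim {: (F' * F)%type})) := \sum_i r 0 i *: B`_i.
  have ldec : linear dec.
    move=> a u v; rewrite /dec scaler_sumr -big_split /=; apply: eq_bigr => i _.
    by rewrite !mxE scalerDl scalerA.
  have surj_dec x : exists r, x = dec r.
    exists (\row_i coord B i x).
    rewrite {1}(coord_vbasis (memvf x)); apply: eq_bigr => i _.
    by rewrite mxE.
  exists (\dim {: (F' * F)%type}); apply/asboolP.
  exists (fun r => (e (dec r).1, (dec r).2)).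
  split=> [a u v|[w z]]; first by rewrite ldec /= le.
  have [v [x ->]] := surj_f w.
  have [r Hr] := surj_dec (x, z - phi v).
  by exists v, r; rewrite -Hr /=; congr pair; rewrite /= addrC subrK.
have [b /asboolP [s [ls surj_s]] minb] := ex_minnP ex_good.
pose G (p : V * 'rV[K]_b) := f1 p.1 + s p.2.
exists b, G; split; last first.
  by move=> v; rewrite /G /= (linear_fun0 ls) addr0.
have lG : linear G.
  by move=> a p q; rewrite /G lf1 ls scalerDr addrACA.
split=> //.
have surj_G t : {p | G p = t}.
  by apply/cid; have [v [x ->]] := surj_s t; exists (v, x).
suff iG : injective G.
  exists (fun t => sval (surj_G t)) => [p|t]; last exact: svalP (surj_G t).
  by apply: iG; exact: svalP (surj_G (G p)).
apply: linear_inj => // -[v x]; rewrite /G /= => vx0; clear G lG surj_G.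
have [x0|/eqP/rV0Pn [i xi]] := pselect (x = 0).
  move: vx0; rewrite x0 (linear_fun0 ls) addr0 => -[fv phiv].
  by rewrite (inj_f v).
(* A nontrivial relation makes the [i]-th added vector redundant. *)
case: b s ls surj_s minb x vx0 i xi => [|b] s ls surj_s minb x vx0 i xi.
  by case: i xi.
pose ins (r : 'rV[K]_b) : 'rV[K]_b.+1 :=
  \row_j (if unlift i j is Some j' then r 0 j' else 0).
have lins : linear ins.
  move=> a r r'; apply/rowP => j; rewrite !mxE.
  by case: unliftP => [j' _|_]; rewrite ?mxE // mulr0 addr0.
suff /minb : `[<good b>] by rewrite ltnn.
apply/asboolP; exists (s \o ins); split=> [a r r'|t] /=;
  first by rewrite lins ls.
have [v' [y ->]] := surj_s t.
pose c := y 0 i / x 0 i.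
exists (v' - c *: v), (\row_j (y - c *: x) 0 (lift i j)).
have -> : ins (\row_j (y - c *: x) 0 (lift i j)) = y - c *: x.
  apply/rowP => j; rewrite mxE; case: unliftP => [j' ->|->]; rewrite ?mxE //.
  by rewrite /c divfK // subrr.
rewrite (linear_funB lf1) (linear_funB ls) (linear_funZ lf1) (linear_funZ ls).
have -> : s x = - f1 v by apply/eqP; rewrite -addr_eq0 addrC vx0.
by rewrite scalerN opprK [s y + _]addrC addrA subrK.
Qed.

(* [v |-> (cV v, (rV a v)_a)] identifies [V] with [C0 + V^A], and similarly
   for [W]; as [f] respects the splittings up to finite rank, adding up the
   indices of the copies of [f] must give back the index of [f]. *)
Lemma self_similar_index (V W : lmodType K) (f : V -> W) (A : finType)
    (C0 C1 F F' : vectType K) (cV : V -> C0) (rV : A -> V -> V)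
    (cW : W -> C1) (rW : A -> W -> W) (phi : V -> F) (e : F' -> W) :
  linear f -> linear cV -> (forall a, linear (rV a)) ->
  linear cW -> (forall a, linear (rW a)) ->
  (forall v, cV v = 0 -> (forall a, rV a v = 0) -> v = 0) ->
  (forall c vs, exists v, cV v = c /\ forall a, rV a v = vs a) ->
  (forall w, cW w = 0 -> (forall a, rW a w = 0) -> w = 0) ->
  (forall c ws, exists w, cW w = c /\ forall a, rW a w = ws a) ->
  finite_rank (fun v => [ffun a => rW a (f v) - f (rV a v)]) ->
  linear phi -> linear e ->
  (forall v, f v = 0 -> phi v = 0 -> v = 0) ->
  (forall w, exists v x, w = f v + e x) ->
  exists p q, (p + (#|A| * q + dim C0) = #|A| * p + dim C1 + q)%N.
Proof.
move=> lf lcV lrV lcW lrW injV surjV injW surjW [F1 [phi1 [e1 [lphi1 le1 fr]]]].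
move=> lphi le injf surjf.
have [b [G [[lG bG] Gf]]] := grushin_exists lf lphi le injf surjf.
pose split_W w : C1 * {ffun A -> W} := (cW w, [ffun a => rW a w]).
have lsW : linear split_W.
  move=> a u v; congr pair; first by rewrite lcW.
  by apply/ffunP => i; rewrite !ffunE lrW.
have bsW : bijective split_W.
  have surj t : {w | split_W w = t}.
    apply/cid; case: t => c ws; have [w [<- Hw]] := surjW c ws; exists w.
    by congr pair; apply/ffunP => a; rewrite ffunE.
  have inj : injective split_W.
    apply: linear_inj => // w [cw /ffunP rw]; apply: injW => // a.
    by have := rw a; rewrite !ffunE.
  exists (fun t => sval (surj t)) => [w|t]; last exact: svalP (surj t).
  by apply: inj; exact: svalP (surj (split_W w)).
pose G1 (p : V * 'rV[K]_b) := (split_W (G p).1, (G p).2).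
pose ev a (p : V * ({ffun A -> 'rV[K]_b} * C1)) := (rV a p.1, p.2.1 a).
have lev a : linear (ev a).
  by move=> c p q; congr pair; rewrite /= ?lrV // !ffunE.
(* [G1] is [G] in the split coordinates of [W]; [G2] runs [G] on every tail separately. The head
   [C0] of the source is then not mapped into the target and the head [C1] is not hit, so they join
   the auxiliary spaces, on opposite sides. *)
pose G2 (p : V * ({ffun A -> 'rV[K]_b} * C1)) :
    (C1 * {ffun A -> W}) * ({ffun A -> F} * C0) :=
  ((p.2.2, [ffun a => (G (ev a p)).1]), ([ffun a => (G (ev a p)).2], cV p.1)).
have grG1 : grushin G1.
  split; first by move=> a p q; rewrite /G1 lG /= lsW.
  have [g Gg gG] := bG; have [h sh hs] := bsW.
  exists (fun t => g (h t.1, t.2)) => [p|[t z]].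
    by rewrite /G1 /= sh -surjective_pairing Gg.
  by rewrite /G1 /= gG /= hs.
have grG2 : grushin G2.
  have lG2 : linear G2.
    move=> a p q; congr (_, _, (_, _)); rewrite /= ?lcV //.
      by apply/ffunP => i; rewrite !ffunE lev lG.
    by apply/ffunP => i; rewrite !ffunE lev lG.
  split=> //.
  have inj : injective G2.
    apply: linear_inj => // -[v [x c]] [] /= -> /ffunP g1 /ffunP g2 cv.
    have gz a : ev a (v, (x, 0)) = 0.
      apply: (bij_inj bG); rewrite (linear_fun0 lG) [G _]surjective_pairing.
      by have := g1 a; have := g2 a; rewrite !ffunE /= => -> ->.
    have -> : v = 0 by apply: injV => // a; case: (gz a).
    by congr (_, (_, _)); apply/ffunP => a; rewrite ffunE; case: (gz a).
  have [g Gg gG] := bG.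
  have surj t : {p | G2 p = t}.
    apply/cid; case: t => -[c ws] [zs c0].
    have [v [cv rv]] := surjV c0 (fun a => (g (ws a, zs a)).1).
    exists (v, ([ffun a => (g (ws a, zs a)).2], c)).
    by congr (_, _, (_, _)) => //=; apply/ffunP => a;
      rewrite !ffunE /ev /= ffunE rv -surjective_pairing gG.
  exists (fun t => sval (surj t)) => [p|t]; last exact: svalP (surj t).
  by apply: inj; exact: svalP (surj (G2 p)).
have E12 v : (G1 (v, 0)).1 - (G2 (v, 0)).1 = (cW (f v), e1 (phi1 v)).
  rewrite -fr /G1 /G2 /= Gf; congr pair; rewrite /= ?subr0 //.
  by apply/ffunP => a; rewrite !ffunE /ev /= ffunE Gf.
have fr12 : finite_rank (fun v => (G1 (v, 0)).1 - (G2 (v, 0)).1).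
  exists (C1 * F1)%type, (fun v => (cW (f v), phi1 v)), (fun x =>
    (x.1, e1 x.2)).
  split=> [a u v|a u v|v]; last exact: E12.
    by congr pair; rewrite /= ?lf ?lcW ?lphi1.
  by congr pair; rewrite /= le1.
have fr21 : finite_rank (fun v => (G2 (v, 0)).1 - (G1 (v, 0)).1).
  have [F2 [phi2 [e2 [l2 l2' E2]]]] := fr12.
  exists F2, phi2, (fun x => - e2 x); split=> // [a u v|v].
    by rewrite l2' opprD scalerN.
  by rewrite -E2 opprB.
exists b, (dim F); apply/eqP; rewrite eqn_leq.
have := grushin_le grG1 grG2 fr12; have := grushin_le grG2 grG1 fr21.
have -> : dim 'rV[K]_b = b by rewrite dim_matrix; exact: mul1n.
have -> : dim ({ffun A -> 'rV[K]_b} * C1)%type = (#|A| * b + dim C1)%N.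
  by rewrite -[b in RHS]mul1n.
by rewrite [dim (_ * _)%type]/dim /= => -> ->.
Qed.

End LinearFunctions.

(** * Norms, square roots and morphisms of C*-algebras *)

Section CStarNorm.
Variables (R : realType) (A : cstarAlgType R).
Implicit Types a b x y : A.

Definition nm (a : A) : R := complex.Re `|a|.

Lemma nmC a : `|a| = (nm a)%:C.
Proof. by rewrite /nm RRe_real // normr_real. Qed.

Lemma nm_ge0 a : 0 <= nm a.
Proof. by rewrite -lecR -nmC normr_ge0. Qed.

Lemma nmD a b : nm (a + b) <= nm a + nm b.
Proof. by rewrite -lecR rmorphD /= -!nmC ler_normD. Qed.

Lemma nmN a : nm (- a) = nm a.
Proof. by rewrite /nm normrN. Qed.

Lemma nmB a b : nm (a - b) = nm (b - a).
Proof. by rewrite /nm distrC. Qed.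

Lemma nm0 : nm (0 : A) = 0.
Proof. by rewrite /nm normr0. Qed.

Lemma nm_eq0 a : nm a = 0 -> a = 0.
Proof. by move=> a0; apply/normr0_eq0; rewrite nmC a0. Qed.

Lemma nmZ (z : R[i]) a : nm (z *: a) = complex.Re `|z| * nm a.
Proof.
have zE : `|z| = (complex.Re `|z|)%:C by rewrite RRe_real // normr_real.
by apply: complexI; rewrite -nmC normrZ zE nmC -rmorphM.
Qed.

Lemma nmZR (r : R) a : nm (r%:C *: a) = `|r| * nm a.
Proof. by rewrite nmZ normc_def /= expr0n addr0 sqrtr_sqr. Qed.

Lemma nmM a b : nm (a * b) <= nm a * nm b.
Proof. by rewrite -lecR rmorphM /= -!nmC; apply: norm_mul_le. Qed.

Lemma nm_starM a : nm (star a * a) = nm a ^+ 2.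
Proof.
by apply: complexI; rewrite -nmC rmorphXn /= -nmC; apply: norm_star_mul.
Qed.

Lemma star0 : star (0 : A) = 0.
Proof. by have /(congr1 (fun z => z - star (0 : A))) := starD (0 : A) 0;
  rewrite addr0 addrK subrr. Qed.

Lemma starN a : star (- a) = - star a.
Proof. by apply/eqP; rewrite -addr_eq0 -starD addNr star0. Qed.

Lemma starB a b : star (a - b) = star a - star b.
Proof. by rewrite starD starN. Qed.

Lemma star_mul a b : star (a * b) = star b * star a.
Proof. exact: starM. Qed.

Lemma star1 : star (1 : A) = 1.
Proof.
by rewrite -[RHS]starK -[star 1]mul1r star_mul starK.
Qed.

Lemma star_sum (I : Type) (r : seq I) (F : I -> A) :
  star (\sum_(i <- r) F i) = \sum_(i <- r) star (F i).
Proof. by apply: (big_morph star (@starD _ _) star0). Qed.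

Lemma nm_star a : nm (star a) = nm a.
Proof.
have le b : nm b <= nm (star b).
  have [->|b0] := eqVneq (nm b) 0; first exact: nm_ge0.
  have b_gt0 : 0 < nm b by rewrite lt_def b0 nm_ge0.
  by rewrite -(ler_pM2r b_gt0) -expr2 -nm_starM nmM.
by apply/eqP; rewrite eq_le le andbT; have := le (star a); rewrite starK.
Qed.

Lemma nm1 : nm (1 : A) = 1.
Proof.
have n0 : nm (1 : A) != 0.
  by apply/eqP => /nm_eq0 /eqP; apply/negP; exact: oner_neq0.
by apply: (mulIf n0); rewrite -expr2 -nm_starM star1 !mul1r.
Qed.

Lemma nm_sum (I : Type) (r : seq I) (P : pred I) (F : I -> A) :
  nm (\sum_(i <- r | P i) F i) <= \sum_(i <- r | P i) nm (F i).
Proof.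
elim/big_ind2: _ => [|x u y v xu yv|//]; first by rewrite nm0.
by rewrite (le_trans (nmD _ _)) // lerD.
Qed.

Lemma nm_small_eq0 a : (forall e : R, 0 < e -> nm a <= e) -> a = 0.
Proof.
move=> small; apply: nm_eq0; apply/eqP; rewrite eq_le nm_ge0 andbT.
by apply/ler_addgt0Pr => e e0; rewrite add0r small.
Qed.

Lemma geometric_small (r c e : R) : 0 <= r < 1 -> 0 < e ->
  exists N, forall m, (N <= m)%N -> c * r ^+ m <= e.
Proof.
move=> /andP[r0 r1] e0.
have : (fun m => c * r ^+ m) @ \oo --> c * 0.
  by apply: cvgMr; apply: cvg_expr; rewrite ger0_norm.
rewrite mulr0 => /cvgrPdist_le /(_ e e0) [N _ HN].
exists N => m Nm; have := HN m Nm; rewrite /= sub0r normrN.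
exact: le_trans (ler_norm _).
Qed.

Lemma geometric_cvg (u : nat -> A) (c r : R) : 0 <= r < 1 ->
  (forall m, nm (u m.+1 - u m) <= c * r ^+ m) ->
  exists l, forall e, 0 < e -> exists N, forall m, (N <= m)%N ->
    nm (u m - l) <= e.
Proof.
move=> r01 du; have [r0 r1] := andP r01.
have r1' : 0 < 1 - r by rewrite subr_gt0.
have c0 : 0 <= c by have := du 0; rewrite expr0 mulr1;
  apply: le_trans (nm_ge0 _).
have dist N j : nm (u (N + j)%N - u N) <= c * r ^+ N / (1 - r).
  apply: (@le_trans _ _ (c * r ^+ N * ((1 - r ^+ j) / (1 - r)))).
    elim: j => [|j IH]; first by rewrite addn0 subrr nm0 expr0 subrr mul0r
      mulr0.
    rewrite addnS -(subrK (u (N + j)%N) (u _.+1)) -addrA.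
    apply: (le_trans (nmD _ _)); apply: (le_trans (lerD (du _) IH)).
    rewrite exprD exprS le_eqVlt; apply/orP; left; apply/eqP.
    by field; rewrite subr_eq0 eq_sym lt_eqF.
  rewrite mulrA ler_pM2r ?invr_gt0 // ler_piMr ?mulr_ge0 ?exprn_ge0 //.
  by rewrite gerBl exprn_ge0.
have : cvg (u @ \oo).
  apply/cauchy_cvgP/cauchy_exP => e e0.
  have eE : e = (complex.Re e)%:C by rewrite RRe_real // gtr0_real.
  have e0' : 0 < complex.Re e by move: e0; rewrite {1}eE ltcR.
  have e2 : 0 < complex.Re e / 2 by rewrite divr_gt0.
  have [N HN] := geometric_small (c / (1 - r)) r01 e2.
  exists (u N); exists N => // m /= Nm.
  rewrite -ball_normE /= distrC nmC eE ltcR -(subnKC Nm).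
  apply: (le_lt_trans (dist _ _)); rewrite mulrAC.
  by apply: (le_lt_trans (HN N (leqnn _))); lra.
move=> /cvg_ex [l /cvgrPdist_le ul]; exists l => e e0.
have e0' : 0 < e%:C by rewrite ltcR.
have [N _ HN] := ul e%:C e0'.
by exists N => m Nm; have := HN m Nm; rewrite /= distrC nmC lecR.
Qed.

(** The root is [1 - y], where [y] solves [y = (x + y^2) / 2]. Iterating the right-hand side from 0
    stays in the ball of radius [nm x < 1], where it is a contraction. Self-adjointness and
    commutation hold for all iterates and pass to the limit. *)
Lemma cstar_sqrt x : star x = x -> nm x < 1 ->
  exists b, [/\ star b = b, b * b = 1 - x &
    forall a, a * x = x * a -> a * b = b * a].
Proof.
move=> sx; set r := nm x => r1; have r0 : 0 <= r := nm_ge0 x.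
pose h : R[i] := (2^-1 : R)%:C.
have hh : h + h = 1 by rewrite -rmorphD /= -[RHS](rmorph1 (real_complex R));
  congr (_ %:C); lra.
pose f y := h *: (x + y * y); pose u m := iter m f 0.
have uS m : u m.+1 = f (u m) by [].
have nmh a : nm (h *: a) = 2^-1 * nm a by rewrite nmZR ger0_norm // invr_ge0.
have ur m : nm (u m) <= r.
  elim: m => [|m IH]; first by rewrite nm0.
  rewrite uS nmh; have := nmD x (u m * u m); have := nmM (u m) (u m).
  rewrite -/r; have := nm_ge0 (u m); move: IH r0 r1.
  move: (nm (u m)) (nm (_ * _)) (nm (_ + _)) r => p q s t; nra.
have du m : nm (u m.+1 - u m) <= r * r ^+ m.
  elim: m => [|m IH].
    rewrite uS /u /= /f mulr0 subr0 addr0 nmh expr0 -/r; move: r0; lra.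
  have -> : u m.+2 - u m.+1 = h *: ((u m.+1 - u m) * u m.+1 + u m * (u m.+1 - u
    m)).
    rewrite !uS -/(u m.+1) -scalerBr mulrBl mulrBr addrA subrK.
    by rewrite opprD addrACA subrr add0r.
  rewrite nmh exprS; move: IH; set d := nm (_ - _); set rm := r ^+ m => IH.
  have := nmD ((u m.+1 - u m) * u m.+1) (u m * (u m.+1 - u m)).
  have := nmM (u m.+1 - u m) (u m.+1); have := nmM (u m) (u m.+1 - u m).
  have := ur m; have := ur m.+1; rewrite -/d.
  have : 0 <= d by apply: nm_ge0.
  have : 0 <= nm (u m) by apply: nm_ge0.
  have : 0 <= nm (u m.+1) by apply: nm_ge0.
  move: (nm (u m)) (nm (u m.+1)) (nm (_ + _)) (nm (_ * _)) (nm (_ * _)).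
  move=> p q s t v p0 q0 d0 qr pr H1 H2 H3.
  have : d * q <= d * r by rewrite ler_wpM2l.
  have : p * d <= r * d by rewrite ler_wpM2r.
  have : r * d <= r * (r * rm) by rewrite ler_wpM2l.
  rewrite [d * r]mulrC; lra.
have r01 : 0 <= r < 1 by rewrite r0.
have [y uy] := geometric_cvg r01 du.
have yr : nm y <= r.
  apply/ler_addgt0Pr => e /uy [N /(_ _ (leqnn _)) HN].
  rewrite -(subrK (u N) y); apply: (le_trans (nmD _ _)).
  by rewrite addrC lerD // nmB.
(* Any Lipschitz identity satisfied by all iterates is inherited by [y]; it is used with
   [star a - a] and with commutators. *)
have lim (g : A -> A) (c : R) :
    (forall a b, nm (g a - g b) <= c * nm (a - b)) ->
    (forall m, g (u m) = 0) -> g y = 0.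
  move=> lip gu; apply: nm_small_eq0 => e e0.
  have c1 : 0 < `|c| + 1 by rewrite ltr_wpDl.
  have [N /(_ _ (leqnn _)) HN] := uy _ (divr_gt0 e0 c1).
  have := lip y (u N); rewrite gu subr0 => /le_trans; apply.
  apply: (@le_trans _ _ ((`|c| + 1) * nm (y - u N))).
    rewrite ler_wpM2r ?nm_ge0 // (le_trans (ler_norm _)) // lerDl //.
  by rewrite mulrC -ler_pdivlMr // nmB.
have sy : star y = y.
  apply/eqP; rewrite -subr_eq0; apply/eqP.
  apply: (lim (fun a => star a - a) 2) => [a b|m].
    have -> : star a - a - (star b - b) = star (a - b) - (a - b).
      by rewrite starB !opprB addrACA [RHS]addrACA [- a - _]addrC.
    apply: (le_trans (nmD _ _)); rewrite nmN nm_star; lra.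
  suff -> : star (u m) = u m by rewrite subrr.
  elim: m => [|m IH]; first exact: star0.
  by rewrite uS /f starZ starD star_mul IH sx; congr (_ *: _);
    exact: conjc_real.
have comm a : a * x = x * a -> a * y = y * a.
  move=> ax; apply/eqP; rewrite -subr_eq0; apply/eqP.
  apply: (lim (fun b => a * b - b * a) (nm a + nm a)) => [b c|m].
    have -> : a * b - b * a - (a * c - c * a) = a * (b - c) - (b - c) * a.
      by rewrite mulrBr mulrBl !opprB addrACA [RHS]addrACA [- (b * a) - _]addrC.
    apply: (le_trans (nmD _ _)); rewrite nmN [leRHS]mulrDl lerD ?nmM //.
    by rewrite (le_trans (nmM _ _)) // mulrC.
  apply/eqP; rewrite subr_eq0; apply/eqP.
  elim: m => [|m IH]; first by rewrite mulr0 mul0r.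
  rewrite uS /f -scalerAr -scalerAl mulrDr mulrDl ax.
  by congr (_ *: (_ + _)); rewrite mulrA IH -mulrA IH mulrA.
have fy : h *: (x + y * y) = y.
  have [N HN] := uy 1 ltr01.
  apply/eqP; rewrite -subr_eq0; apply/eqP; apply: nm_small_eq0 => e e0.
  have [M HM] := uy (e / 2) (divr_gt0 e0 (ltr0Sn _ 1)).
  have -> : h *: (x + y * y) - y =
    h *: ((y - u M) * y + u M * (y - u M)) + (u M.+1 - y).
    have -> : (y - u M) * y + u M * (y - u M) = y * y - u M * u M.
      by rewrite mulrBl mulrBr addrA subrK.
    rewrite uS /f addrA -scalerDr; congr (h *: _ - y).
    by rewrite [x + u M * _]addrC addrA subrK addrC.
  have H1 := HM M (leqnn _); have H2 := HM M.+1 (leqnSn _).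
  apply: (le_trans (nmD _ _)); rewrite nmh.
  have := nmD ((y - u M) * y) (u M * (y - u M)).
  have := nmM (y - u M) y; have := nmM (u M) (y - u M).
  rewrite nmB in H1; move: H1 H2 (ur M) yr (nm_ge0 y) (nm_ge0 (u M)) (nm_ge0 (y
    - u M)).
  move: (nm (y - u M)) (nm (u M.+1 - y)) (nm (u M)) (nm y)
    (nm (_ * y + _)) (nm (_ * _)) (nm (_ * _)).
  move=> a b c d s t v H1 H2 cr dr d0 c0 a0 H3 H4 H5.
  have : a * d <= a * 1 by apply: ler_wpM2l => //; exact: le_trans dr (ltW r1).
  have : c * a <= 1 * a by apply: ler_wpM2r => //; exact: le_trans cr (ltW r1).
  lra.
exists (1 - y); split.
- by rewrite starB star1 sy.
- have : x + y * y = y + y.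
    by rewrite -[LHS]scale1r -hh scalerDl fy.
  move=> /(canRL (addrK _)) ->.
  by rewrite mulrBr mulr1 mulrBl mul1r -[y + y - y * y]addrA [in RHS]opprD
    addrA.
- by move=> a /comm ay; rewrite mulrBr mulrBl mulr1 mul1r ay.
Qed.

Lemma cstar_sqrt_gap x : nm x < 1 ->
  exists b, star b = b /\ b * b = 1 - star x * x.
Proof.
move=> x1; have [||b [sb bb _]] := @cstar_sqrt (star x * x).
- by rewrite star_mul starK.
- by rewrite nm_starM expr_lt1 // nm_ge0.
- by exists b.
Qed.

(* [nm a <= nm (a + i b)], as [a] is the real part of [a + i b]. *)
Lemma nm_sqr_le_sum (a b : A) : star a = a -> star b = b -> a * b = b * a ->
  nm a ^+ 2 <= nm (a * a + b * b).
Proof.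
move=> sa sb ab; pose i : R[i] := 'i%C.
have ii : i * i = -1 by rewrite -expr2 sqr_i.
have ic : i^* = - i by apply/eqP; rewrite eq_complex /= oppr0 !eqxx.
pose u := a + i *: b; pose u' := a - i *: b.
have su : star u = u' by rewrite /u starD starZ sa sb [(i^*)%R]ic scaleNr.
have uu : star u * u = a * a + b * b.
  rewrite su mulrBl !mulrDr -!scalerAl -!scalerAr scalerA ii scaleN1r ab.
  by rewrite opprD opprK addrA addrK.
have aE : a = (2^-1 : R)%:C *: (u + u').
  rewrite /u /u' addrACA subrr addr0 scalerDr -scalerDl -rmorphD /=.
  have -> : 2^-1 + 2^-1 = 1 :> R by lra.
  by rewrite scale1r.
rewrite -uu nm_starM ler_pXn2r // ?nnegrE ?nm_ge0 //.
rewrite {1}aE nmZR ger0_norm ?invr_ge0 //.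
have := nmD u u'; rewrite -su nm_star; lra.
Qed.

(* Kadison: [1] is an extreme point of the unit ball.  With [c = 1 + h^2] and
   [b^2 = 1 - (1 - d) c], one gets [h^2 + b^2 = d c], which is small. *)
Lemma one_extreme h : star h = h -> nm (1 + h) <= 1 -> nm (1 - h) <= 1 -> h = 0.
Proof.
move=> sh hp hm; pose c := 1 + h * h.
have sc : star c = c by rewrite /c starD star1 star_mul sh.
have hc : h * c = c * h by rewrite /c mulrDl mulrDr mulr1 mul1r mulrA.
have nc : nm c <= 1.
  have -> : c = (2^-1 : R)%:C *: ((1 + h) * (1 + h) + (1 - h) * (1 - h)).
    have -> : (1 + h) * (1 + h) = c + (h + h).
      by rewrite mulrDl mul1r mulrDr mulr1 [h + h * h]addrC addrACA.
    have -> : (1 - h) * (1 - h) = c - (h + h).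
      by rewrite mulrBl mul1r mulrBr mulr1 opprB addrACA -opprD.
    rewrite addrACA subrr addr0 scalerDr -scalerDl -rmorphD /=.
    have -> : 2^-1 + 2^-1 = 1 :> R by lra.
    by rewrite scale1r.
  rewrite nmZR ger0_norm ?invr_ge0 //.
  have := nmD ((1 + h) * (1 + h)) ((1 - h) * (1 - h)).
  have := nmM (1 + h) (1 + h); have := nmM (1 - h) (1 - h).
  have : nm (1 + h) * nm (1 + h) <= 1 * 1 by rewrite ler_pM ?nm_ge0.
  have : nm (1 - h) * nm (1 - h) <= 1 * 1 by rewrite ler_pM ?nm_ge0.
  lra.
apply: nm_small_eq0 => e e0.
pose d := Num.min (e ^+ 2) 2^-1.
have d0 : 0 < d by rewrite lt_min exprn_gt0 // invr_gt0 ltr0n.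
have d1 : d < 1 by rewrite gt_min; apply/orP; right; rewrite invf_lt1 // ltr1n.
have sx : star ((1 - d)%:C *: c) = (1 - d)%:C *: c.
  by rewrite starZ sc; congr (_ *: _); exact: conjc_real.
have [|b [sb bb comm]] := cstar_sqrt sx.
  rewrite nmZR gtr0_norm ?subr_gt0 // (le_lt_trans (ler_wpM2l _ nc)) //.
    by rewrite subr_ge0 ltW.
  by rewrite mulr1 ltrBlDr ltrDl.
have hb : h * b = b * h by apply: comm; rewrite -scalerAr -scalerAl hc.
have := nm_sqr_le_sum sh sb hb.
have -> : h * h + b * b = d%:C *: c.
  have -> : h * h = c - 1 by rewrite /c addrC addKr.
  rewrite bb rmorphB scalerBl rmorph1 scale1r addrA subrK opprB.
  by rewrite addrC subrK.
rewrite nmZR gtr0_norm // => H.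
rewrite -(@ler_pXn2r _ 2) // ?nnegrE ?nm_ge0 ?(ltW e0) //.
apply: (le_trans H); apply: (@le_trans _ _ d).
  by rewrite -[leRHS]mulr1 ler_wpM2l // ltW.
by rewrite ge_min lexx.
Qed.

End CStarNorm.

(** * Contractivity of star-homomorphisms *)

Section Contractive.
Variables (R : realType) (A B : cstarAlgType R) (phi : {lrmorphism A -> B}).
Hypothesis phi_star : star_preserving phi.

(** A self-adjoint [b] commuting with [a] and satisfying [a^2 + b^2 = 1] exists in [A]. The relation
    is algebraic, so it survives [phi] and bounds the norm of [phi a] in [B]. *)
Lemma star_morphism_le1 (a : A) : star a = a -> nm a < 1 -> nm (phi a) <= 1.
Proof.
move=> sa a1.
have saa : star (a * a) = a * a by rewrite star_mul sa.
have naa : nm (a * a) < 1 by rewrite -{1}sa nm_starM expr_lt1 // nm_ge0.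
have [b [sb bb comm]] := cstar_sqrt saa naa.
have ab : a * b = b * a by apply: comm; rewrite mulrA.
have := @nm_sqr_le_sum _ _ (phi a) (phi b).
rewrite -!phi_star sa sb -!rmorphM ab bb -rmorphD addrC subrK rmorph1 nm1.
by move=> /(_ erefl erefl erefl); rewrite expr_le1 ?nm_ge0.
Qed.

(** By the C*-identity it suffices to treat [star x * x], scaled to have norm less than 1. *)
Lemma star_morphism_contractive (x : A) : nm (phi x) <= nm x.
Proof.
apply/ler_addgt0Pr => e e0; set r := nm x + e.
have r0 : 0 < r by rewrite ltr_wpDl // nm_ge0.
have r2 : 0 < (r ^+ 2)^-1 by rewrite invr_gt0 exprn_gt0.
pose a := ((r ^+ 2)^-1)%:C *: (star x * x).
have : nm (phi a) <= 1.
  apply: star_morphism_le1.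
    by rewrite starZ star_mul starK; congr (_ *: _); exact: conjc_real.
  rewrite nmZR gtr0_norm // nm_starM -exprVn -exprMn expr_lt1 //.
    by rewrite mulrC ltr_pdivrMr // mul1r ltrDl.
  by rewrite mulr_ge0 ?nm_ge0 // invr_ge0 ltW.
rewrite linearZ /= nmZR gtr0_norm // rmorphM /= phi_star nm_starM.
rewrite mulrC ler_pdivrMr ?exprn_gt0 // mul1r.
by move=> H; rewrite -(@ler_pXn2r _ 2) // nnegrE ?nm_ge0 // ltW.
Qed.

End Contractive.

(** * Operators on the full Fock space *)

Section WordSums.
Variable n : nat.

(** Peeling off the first letter matches the action of the generators; [wsum_cat] regroups the same
    sum by the last letters, as the splitting of the sectors needs. *)
Fixpoint wsum (V : nmodType) (l : nat) (g : seq 'I_n -> V) : V :=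
  if l is l'.+1 then \sum_(i < n) wsum l' (fun mu => g (i :: mu)) else g [::].

Lemma eq_wsum (V : nmodType) l (g h : seq 'I_n -> V) :
  (forall mu, size mu = l -> g mu = h mu) -> wsum l g = wsum l h.
Proof.
elim: l g h => [|l IH] g h gh /=; first exact: gh.
by apply: eq_bigr => i _; apply: IH => mu lmu; apply: gh; rewrite /= lmu.
Qed.

Lemma wsum0 (V : nmodType) l (g : seq 'I_n -> V) :
  (forall mu, size mu = l -> g mu = 0) -> wsum l g = 0.
Proof.
elim: l g => [|l IH] g g0 /=; first exact: g0.
by rewrite big1 // => i _; apply: IH => mu lmu; apply: g0; rewrite /= lmu.
Qed.

Lemma wsum_morph (V W : nmodType) (f : V -> W) l (g : seq 'I_n -> V) :
  f 0 = 0 -> {morph f : x y / x + y} ->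
  f (wsum l g) = wsum l (fun mu => f (g mu)).
Proof.
move=> f0 fD; elim: l g => [|l IH] g //=.
by rewrite (big_morph f fD f0); apply: eq_bigr => i _.
Qed.

Lemma wsumD (V : nmodType) l (g h : seq 'I_n -> V) :
  wsum l (fun mu => g mu + h mu) = wsum l g + wsum l h.
Proof.
elim: l g h => [|l IH] g h //=.
by rewrite -big_split; apply: eq_bigr => i _.
Qed.

Lemma wsum_sum (V : nmodType) (I : Type) (r : seq I) l
    (g : I -> seq 'I_n -> V) :
  wsum l (fun mu => \sum_(i <- r) g i mu) = \sum_(i <- r) wsum l (g i).
Proof.
elim: r => [|a r IH].
  by rewrite big_nil wsum0 // => mu _; rewrite big_nil.
rewrite big_cons -IH -wsumD; apply: eq_wsum => mu _.
by rewrite big_cons.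
Qed.

Lemma wsum_cat (V : nmodType) m k (g : seq 'I_n -> V) :
  wsum (m + k) g = wsum k (fun al => wsum m (fun mu => g (mu ++ al))).
Proof.
elim: m g => [|m IH] g //=.
by rewrite wsum_sum; apply: eq_bigr => i _; rewrite IH.
Qed.

Lemma wsum_rcons (V : nmodType) l (g : seq 'I_n -> V) :
  wsum l.+1 g = \sum_(i < n) wsum l (fun mu => g (rcons mu i)).
Proof.
rewrite -addn1 wsum_cat /=; apply: eq_bigr => i _; apply: eq_wsum => mu _.
by rewrite cats1.
Qed.

Lemma wsum_le (R : numDomainType) l (g h : seq 'I_n -> R) :
  (forall mu, size mu = l -> g mu <= h mu) -> wsum l g <= wsum l h.
Proof.
elim: l g h => [|l IH] g h gh /=; first exact: gh.
by apply: ler_sum => i _; apply: IH => mu lmu; apply: gh; rewrite /= lmu.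
Qed.

Lemma wsum_ge0 (R : numDomainType) l (g : seq 'I_n -> R) :
  (forall mu, 0 <= g mu) -> 0 <= wsum l g.
Proof.
move=> g0; rewrite -(@wsum0 R l (fun=> 0)) //; exact: wsum_le.
Qed.

Lemma wsum_ge_term (R : numDomainType) (g : seq 'I_n -> R) mu :
  (forall mu, 0 <= g mu) -> g mu <= wsum (size mu) g.
Proof.
elim: mu g => [|i mu IH] g g0 //=.
rewrite (bigD1 i) //= (le_trans (IH (fun nu => g (i :: nu)) _)) //.
by rewrite lerDl sumr_ge0 // => j _; exact: wsum_ge0.
Qed.

End WordSums.

Section Fock.
Variables (R : realType) (n : nat).
Local Notation fock := (seq 'I_n -> R[i]^o).
Implicit Types (xi eta : fock) (mu : seq 'I_n).

(* [(i, true)] stands for [S_i] and [(i, false)] for its adjoint. *)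
Definition letter := ('I_n * bool)%type.
(** Formal lists, because they are evaluated in two places that are not related by a homomorphism: 1
    minus the sum of the range projections is 0 in the Cuntz algebra but is the vacuum projection on
    the Fock space. *)
Definition ncpoly := seq (R[i] * seq letter).

(** Left creation and annihilation. A vector is an arbitrary function on words; square-summability
    is imposed later, on the sectors. *)
Definition fock_letter (e : letter) xi : fock := fun mu =>
  if e.2 then if mu is j :: nu then if j == e.1 then xi nu else 0 else 0
  else xi (e.1 :: mu).

Definition fock_word (w : seq letter) xi : fock := foldr fock_letter xi w.

Definition fock_poly (p : ncpoly) xi : fock := fun mu =>
  \sum_(t <- p) t.1 * fock_word t.2 xi mu.

Definition ncmul (p q : ncpoly) : ncpoly :=
  [seq (s.1 * t.1, s.2 ++ t.2) | s <- p, t <- q].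

Definition ncadj (p : ncpoly) : ncpoly :=
  [seq (t.1^*, rev [seq (e.1, ~~ e.2) | e <- t.2]) | t <- p].

Definition ncscale (c : R[i]) (p : ncpoly) : ncpoly :=
  [seq (c * t.1, t.2) | t <- p].

Definition ncdeg (p : ncpoly) := \max_(t <- p) size t.2.

Lemma fock_letter_linear e : linear (fock_letter e).
Proof.
move=> a xi eta; apply/funext => mu; case: e => i [] //=.
rewrite !fctE /fock_letter /=; case: mu => [|j mu] /=.
  by rewrite scaler0 addr0.
by case: eqP; rewrite // scaler0 addr0.
Qed.

Lemma fock_word_linear w : linear (fock_word w).
Proof. by elim: w => [|e w IH] a xi eta //=; rewrite IH fock_letter_linear. Qed.

Lemma fock_poly_linear p : linear (fock_poly p).
Proof.
move=> a xi eta; apply/funext => mu; rewrite !fctE /fock_poly.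
rewrite scaler_sumr -big_split; apply: eq_bigr => t _ /=.
by rewrite fock_word_linear !fctE mulrDr; congr (_ + _); exact: mulrCA.
Qed.

Lemma fock_poly_mul p q xi : fock_poly (ncmul p q) xi = fock_poly p (fock_poly
  q xi).
Proof.
have lin w (r : ncpoly) : fock_word w (fock_poly r xi) =
    fun mu => \sum_(t <- r) t.1 * fock_word w (fock_word t.2 xi) mu.
  elim: w => [|e w IH] //=; rewrite IH; apply/funext => mu.
  case: e => i [] //=; rewrite /fock_letter /=.
  case: mu => [|j mu] /=; first by rewrite big1 // => t _; rewrite mulr0.
  by case: eqP => // _; rewrite big1 // => t _; rewrite mulr0.
apply/funext => mu; rewrite /fock_poly big_allpairs_dep /=.
apply: eq_bigr => s _; rewrite -/(fock_poly q xi) lin mulr_sumr.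
by apply: eq_bigr => t _ /=; rewrite /fock_word foldr_cat mulrA.
Qed.

Lemma fock_poly_cat p q xi : fock_poly (p ++ q) xi = fock_poly p xi + fock_poly
  q xi.
Proof. by apply/funext => mu; rewrite !fctE /fock_poly big_cat. Qed.

Lemma fock_poly_scale c p xi : fock_poly (ncscale c p) xi = c *: fock_poly p xi.
Proof.
apply/funext => mu; rewrite !fctE /fock_poly big_map scaler_sumr.
by apply: eq_bigr => t _ /=; rewrite -mulrA.
Qed.

Lemma size_ncdeg p t : t \in p -> (size t.2 <= ncdeg p)%N.
Proof. by move=> tp; exact: (@leq_bigmax_seq _ p predT (fun t =>
  size t.2)). Qed.

Definition supported a l xi := forall mu, ~~ (a <= size mu < l)%N -> xi mu = 0.

Lemma supported_letter a l e xi : supported a.+1 l xi ->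
  supported a l.+1 (fock_letter e xi).
Proof.
move=> sxi mu mul; case: e => i []; rewrite /fock_letter /=.
  case: mu mul => [//|j mu] mul; case: eqP => // _; apply: sxi.
  by apply: contra mul => /andP[amu mul]; rewrite /= ltnS mul (leqW (ltnW amu)).
apply: sxi; apply: contra mul => /= /andP[amu mul]; rewrite -ltnS amu /=.
by rewrite ltnW // ltnW.
Qed.

Lemma supported_word a l w xi : supported (a + size w) l xi ->
  supported a (l + size w) (fock_word w xi).
Proof.
elim: w a => [|e w IH] a /=; first by rewrite !addn0.
by rewrite !addnS -addSn => /IH /supported_letter.
Qed.

Lemma supportedW a b l m xi : (b <= a)%N -> (l <= m)%N ->
  supported a l xi -> supported b m xi.
Proof.
move=> ba lm s mu mul; apply: s; apply: contra mul => /andP[amu mul].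
by rewrite (leq_trans ba amu) (leq_trans mul lm).
Qed.

(** The gauge action implemented on the Fock space. *)
Definition twist (z : R[i]) xi : fock := fun mu => z ^+ size mu * xi mu.

(** The gauge eigenvalue of a letter; for a primitive [k]-th root [z], the product over a word
    records its degree mod [k]. *)
Definition letter_weight (z : R[i]) (e : letter) := if e.2 then z else z^-1.
Definition weight z (w : seq letter) := \prod_(e <- w) letter_weight z e.

Lemma twist_letter z e xi : z != 0 -> twist z (fock_letter e xi) =
  letter_weight z e *: fock_letter e (twist z xi).
Proof.
move=> z0; apply/funext => mu; rewrite !fctE /twist /letter_weight /fock_letter.
case: e => i [] /=.
  case: mu => [|j mu] /=; first by rewrite mulr0 scaler0.
  by case: eqP => _; rewrite ?mulr0 ?scaler0 // exprS -mulrA.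
by rewrite exprS -[RHS]/(_ * _) mulrA mulKf.
Qed.

Lemma twist_word z w xi : z != 0 -> twist z (fock_word w xi) =
  weight z w *: fock_word w (twist z xi).
Proof.
move=> z0; rewrite /weight; elim: w xi => [|e w IH] xi /=.
  by rewrite big_nil scale1r.
rewrite twist_letter // IH big_cons -scalerA; congr (_ *: _).
by rewrite (linear_funZ (fock_letter_linear e)).
Qed.

Lemma twist_poly z c p xi : z != 0 -> (forall t, t \in p -> weight z t.2 = c) ->
  twist z (fock_poly p xi) = c *: fock_poly p (twist z xi).
Proof.
move=> z0 pc; apply/funext => mu; rewrite !fctE /twist /fock_poly.
rewrite mulr_sumr scaler_sumr; apply: eq_big_seq => t tp.
rewrite mulrCA -/(twist z (fock_word t.2 xi) mu) twist_word // pc // fctE.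
exact: mulrCA.
Qed.

(** Letters act at the front, and [w] can strip at most [size w] letters from the argument, so it
    never reaches [al]. This is the source of the self-similarity up to finite rank. *)
Lemma fock_word_rcat w al xi mu : (size w <= size mu)%N ->
  fock_word w xi (mu ++ al) = fock_word w (fun nu => xi (nu ++ al)) mu.
Proof.
elim: w mu => [|[i []] w IH] mu //= lw; rewrite /fock_letter /=.
  by case: mu lw => [//|j mu] lw /=; case: eqP => // _; rewrite IH.
by rewrite -cat_cons IH // ltnW // ltnS ltnW.
Qed.

Lemma fock_poly_rcat p al xi mu : (ncdeg p <= size mu)%N ->
  fock_poly p xi (mu ++ al) = fock_poly p (fun nu => xi (nu ++ al)) mu.
Proof.
move=> pmu; apply: eq_big_seq => t tp.
by rewrite fock_word_rcat // (leq_trans (size_ncdeg tp)).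
Qed.

Lemma fock_word_local w l xi eta : (forall nu, (size nu < l + size w)%N ->
  xi nu = eta nu) ->
  forall mu, (size mu < l)%N -> fock_word w xi mu = fock_word w eta mu.
Proof.
elim: w l => [|[i b] w IH] l /=; first by rewrite addn0.
rewrite addnS -addSn => H mu mul; have {}IH := IH _ H.
case: b; rewrite /fock_letter /=; last by rewrite IH.
by case: mu mul => [//|j mu] mul; case: eqP => // _; rewrite IH // ltnW // ltnW.
Qed.

Lemma fock_poly_local p D l xi eta : (ncdeg p <= D)%N ->
  (forall nu, (size nu < l + D)%N -> xi nu = eta nu) ->
  forall mu, (size mu < l)%N -> fock_poly p xi mu = fock_poly p eta mu.
Proof.
move=> pD H mu mul; apply: eq_big_seq => t tp; congr (_ * _).
apply: (@fock_word_local _ l) => // nu lnu; apply: H.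
by rewrite (leq_trans lnu) // leq_add2l (leq_trans (size_ncdeg tp)).
Qed.

End Fock.

(** * Noncommutative polynomials in the generators *)

Section Evaluation.
Variables (R : realType) (A : cstarAlgType R) (n : nat) (S : 'I_n -> A).
Local Notation fock := (seq 'I_n -> R[i]^o).
Implicit Types (xi eta : fock) (mu : seq 'I_n) (p q : ncpoly R n).

Definition ev_letter (e : letter n) : A := if e.2 then S e.1 else star (S e.1).
Definition ev_word (w : seq (letter n)) : A := \prod_(e <- w) ev_letter e.
Definition ev (p : ncpoly R n) : A := \sum_(t <- p) t.1 *: ev_word t.2.
Definition Sword mu : A := \prod_(i <- mu) S i.

Lemma ev_cat p q : ev (p ++ q) = ev p + ev q.
Proof. by rewrite /ev big_cat. Qed.

Lemma ev_scale c p : ev (ncscale c p) = c *: ev p.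
Proof.
rewrite /ev big_map scaler_sumr; apply: eq_bigr => t _.
by rewrite scalerA.
Qed.

Lemma ev_mul p q : ev (ncmul p q) = ev p * ev q.
Proof.
rewrite /ev big_allpairs_dep /= mulr_suml; apply: eq_bigr => s _.
rewrite mulr_sumr; apply: eq_bigr => t _ /=.
by rewrite -scalerAl -scalerAr scalerA /ev_word big_cat.
Qed.

Lemma ev1 : ev [:: (1, [::])] = 1.
Proof. by rewrite /ev big_seq1 /ev_word big_nil scale1r. Qed.

Lemma ev_gen i : ev [:: (1, [:: (i, true)])] = S i.
Proof. by rewrite /ev big_seq1 /ev_word big_seq1 scale1r. Qed.

Lemma ev_adj p : ev (ncadj p) = star (ev p).
Proof.
rewrite /ev star_sum big_map; apply: eq_bigr => t _ /=.
rewrite starZ; congr (_ *: _); elim: t.2 => [|e w IH].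
  by rewrite /ev_word !big_nil star1.
rewrite /= rev_cons /ev_word -cats1 big_cat [in RHS]big_cons star_mul.
rewrite -/(ev_word w) -IH big_seq1; congr (_ * _).
by case: e => i [] //=; rewrite /ev_letter /= starK.
Qed.

(** The limits of polynomials form a closed star-subalgebra containing the generators. *)
Lemma ev_dense : cstar_generated S ->
  forall x (e : R), 0 < e -> exists p, nm (x - ev p) <= e.
Proof.
pose D : set A := [set x | forall e : R, 0 < e -> exists p, nm (x - ev p) <= e].
have evD p : D (ev p) by move=> e e0; exists p; rewrite subrr nm0 ltW.
move=> gen; suff DT : D = setT.
  by move=> x; have : D x by rewrite DT.
apply: gen => [x clx e e0|| i]; last by rewrite -ev_gen.
  have e2 : 0 < (e / 2)%:C by rewrite ltcR divr_gt0.
  have [y [Dy]] := clx _ (nbhsx_ballx x _ e2).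
  rewrite -ball_normE /= nmC ltcR => xy.
  have [p py] := Dy (e / 2) (divr_gt0 e0 (ltr0Sn _ 1)).
  exists p; rewrite -(subrK y x) -addrA (le_trans (nmD _ _)) //; lra.
split.
- by rewrite -ev1.
- move=> x y Dx Dy e e0.
  have [p px] := Dx (e / 2) (divr_gt0 e0 (ltr0Sn _ 1)).
  have [q qy] := Dy (e / 2) (divr_gt0 e0 (ltr0Sn _ 1)).
  exists (p ++ q); rewrite ev_cat opprD addrACA (le_trans (nmD _ _)) //; lra.
- move=> x y Dx Dy e e0.
  have y0 : 0 < nm y + 1 by rewrite ltr_wpDl ?nm_ge0.
  have [p px] := Dx (e / 2 / (nm y + 1)) (divr_gt0 (divr_gt0 e0 (ltr0Sn _ 1))
    y0).
  have p0 : 0 < nm (ev p) + 1 by rewrite ltr_wpDl ?nm_ge0.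
  have [q qy] := Dy (e / 2 / (nm (ev p) + 1)) (divr_gt0 (divr_gt0 e0 (ltr0Sn _
    1)) p0).
  exists (ncmul p q); rewrite ev_mul.
  have -> : x * y - ev p * ev q = (x - ev p) * y + ev p * (y - ev q).
    by rewrite mulrBl mulrBr addrA subrK.
  apply: (le_trans (nmD _ _)).
  have : nm ((x - ev p) * y) <= e / 2.
    apply: (le_trans (nmM _ _)); move: px; rewrite ler_pdivlMr //.
    by apply: le_trans; rewrite ler_wpM2l ?nm_ge0 // lerDl.
  have : nm (ev p * (y - ev q)) <= e / 2.
    apply: (le_trans (nmM _ _)); move: qy; rewrite ler_pdivlMr // mulrC.
    by apply: le_trans; rewrite ler_wpM2r ?nm_ge0 // lerDl.
  lra.
- move=> z x Dx e e0.
  have z0 : 0 < complex.Re `|z| + 1.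
    by rewrite ltr_wpDl //; have := normr_ge0 z; rewrite lecE => /andP[].
  have [p px] := Dx (e / (complex.Re `|z| + 1)) (divr_gt0 e0 z0).
  exists (ncscale z p); rewrite ev_scale -scalerBr nmZ.
  move: px; rewrite ler_pdivlMr // mulrC; apply: le_trans.
  by rewrite ler_wpM2r ?nm_ge0 // lerDl.
- move=> x Dx e e0; have [p px] := Dx e e0.
  by exists (ncadj p); rewrite ev_adj -starB nm_star.
Qed.

End Evaluation.

(** * Orthogonality of the ranges of the generators *)

Section Isometries.
Variables (R : realType) (A : cstarAlgType R) (n : nat) (S : 'I_n -> A).
Hypothesis relS : cuntz_relations S.

Lemma isometry_le1 i : nm (S i) <= 1.
Proof.
have := nm_starM (S i); rewrite relS.1 nm1 => /esym/eqP.
by rewrite sqrp_eq1 ?nm_ge0 // => /eqP ->.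
Qed.

(* As the range projections sum to 1, [sum_(j != i) d_j = 0] for
   [d_j = S_i^* S_j S_j^* S_i].  Each [1 - d_j] is a contraction, and [- d_j] is
   the sum of the other [d_l]; so [1 + d_j / t] and [1 - d_j / t] are both
   contractions for large [t], and [d_j = 0] since 1 is extreme. *)
Lemma cuntz_orthogonal i j : i != j -> star (S i) * S j = 0.
Proof.
move=> ij; pose d k := star (S i) * (S k * star (S k)) * S i.
have sd k : star (d k) = d k by rewrite /d !star_mul !starK !mulrA.
have projk k : nm (1 - S k * star (S k)) <= 1.
  set q := 1 - _.
  have sq : star q = q by rewrite /q starB star1 star_mul starK.
  have qq : q * q = q.
    rewrite /q mulrBl mul1r mulrBr mulr1 -mulrA [star _ * _]mulrA relS.1 mul1r.
    by rewrite subrr subr0.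
  have := nm_starM q; rewrite sq qq => H.
  have [-> //|q0] := eqVneq (nm q) 0.
  have : nm q * 1 = nm q * nm q by rewrite mulr1 -expr2.
  by move=> /(mulfI q0) <-.
have dk k : nm (1 - d k) <= 1.
  have -> : 1 - d k = star (S i) * (1 - S k * star (S k)) * S i.
    by rewrite mulrBr mulrBl mulr1 relS.1.
  apply: (le_trans (nmM _ _)); rewrite -[leRHS]mulr1.
  rewrite ler_pM ?nm_ge0 ?isometry_le1 // (le_trans (nmM _ _)) // -[leRHS]mulr1.
  by rewrite ler_pM ?nm_ge0 // nm_star isometry_le1.
have sumd : \sum_k d k = 1.
  by rewrite /d -mulr_suml -mulr_sumr relS.2 mulr1 relS.1.
have di : d i = 1 by rewrite /d mulrA relS.1 mul1r relS.1.
have sumd0 : \sum_(k | k != i) d k = 0.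
  by move: sumd; rewrite (bigD1 i) //= di => /(canRL (addKr _)); rewrite addNr.
have dj : d j = - \sum_(k | (k != i) && (k != j)) d k.
  move: sumd0; rewrite (bigD1 j) 1?eq_sym //= => /eqP.
  by rewrite addr_eq0 => /eqP.
pose t : R := (n.+1)%:R.
have t0 : 0 < t by rewrite ltr0n.
have t1 : 1 <= t by rewrite ler1n.
(* Convexity: [t] times [1 + x / t] is [m + x] plus [t - m] copies of the unit. The choice
   [t = n + 1] dominates both values of [m] used below, the number of remaining indices and 1. *)
have shift (m : nat) (x : A) : nm (m%:R%:C *: 1 + x) <= m%:R ->
    (m <= n.+1)%N -> nm (1 + t^-1%:C *: x) <= 1.
  move=> mx mn.
  have -> : 1 + t^-1%:C *: x =
    t^-1%:C *: ((m%:R%:C *: 1 + x) + (n.+1 - m)%N%:R%:C *: 1).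
    rewrite addrAC -scalerDl -rmorphD /= -natrD subnKC // scalerDr scalerA.
    by rewrite -rmorphM /= mulVf ?gt_eqF // rmorph1 scale1r.
  rewrite nmZR gtr0_norm ?invr_gt0 // mulrC ler_pdivrMr // mul1r.
  apply: (le_trans (nmD _ _)); rewrite nmZR nm1 mulr1 ger0_norm //.
  by rewrite [leRHS](_ : t = m%:R + (n.+1 - m)%:R) ?lerD2r // -natrD subnKC.
have h0 : t^-1%:C *: d j = 0.
  apply: one_extreme.
  - by rewrite starZ sd; congr (_ *: _); exact: conjc_real.
  - apply: (shift #|[pred k | (k != i) && (k != j)]|); last first.
      by rewrite (leq_trans (max_card _)) // card_ord.
    rewrite dj -sum1_card natr_sum rmorph_sum scaler_suml -sumrB.
    apply: (le_trans (nm_sum _ _ _)); apply: ler_sum => k _.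
    by rewrite scale1r dk.
  - by rewrite -scalerN; apply: (shift 1%N) => //; rewrite scale1r dk.
have dj0 : d j = 0.
  move/eqP: h0; rewrite scaler_eq0 => /orP[/eqP/complexI/eqP|/eqP //].
  by rewrite invr_eq0 gt_eqF.
rewrite -[LHS]starK star_mul starK; apply/eqP.
suff -> : star (S j) * S i = 0 by rewrite star0.
apply: nm_eq0; apply/eqP; rewrite -sqrf_eq0 -nm_starM star_mul starK.
by rewrite -mulrA [S j * _]mulrA mulrA -/(d j) dj0 nm0.
Qed.

End Isometries.

(** * Fock vectors inside the Cuntz algebra *)

Section Vectors.
Variables (R : realType) (A : cstarAlgType R) (n : nat) (S : 'I_n -> A).
Hypothesis relS : cuntz_relations S.
Local Notation fock := (seq 'I_n -> R[i]^o).
Implicit Types (xi eta : fock) (mu : seq 'I_n) (p q : ncpoly R n).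

Definition sqc (c : R[i]) : R := complex.Re c ^+ 2 + complex.Im c ^+ 2.

Lemma sqcE c : (sqc c)%:C = c^* * c.
Proof. by rewrite /sqc add_Re2_Im2 sqr_normc mulrC. Qed.

Lemma sqc_ge0 c : 0 <= sqc c.
Proof. by rewrite addr_ge0 // sqr_ge0. Qed.

Definition layer l xi : A := wsum l (fun mu => xi mu *: Sword S mu).
(** A truncated Fock vector realised in [A], with the word [mu] represented by the product of its
    generators. Left multiplication in [A] then imitates the Fock action, as long as the vacuum is
    not reached. *)
Definition Xvec l xi : A := \sum_(m < l) layer m xi.
Definition nrm2 l xi : R := \sum_(m < l) wsum m (fun mu => sqc (xi mu)).

Lemma nrm2_ge0 l xi : 0 <= nrm2 l xi.
Proof. by apply: sumr_ge0 => m _; apply: wsum_ge0 => mu; exact: sqc_ge0. Qed.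

Lemma layer0 l xi : (forall mu, size mu = l -> xi mu = 0) -> layer l xi = 0.
Proof. by move=> xi0; apply: wsum0 => mu /xi0 ->; rewrite scale0r. Qed.

Lemma layerS l xi : layer l.+1 xi = \sum_(i < n) S i * layer l (fun mu =>
  xi (i :: mu)).
Proof.
apply: eq_bigr => i _; rewrite /layer (wsum_morph _ _ (mulr0 (S i))).
  by apply: eq_wsum => mu _; rewrite /Sword big_cons scalerAr.
exact: mulrDr.
Qed.

(** Words of equal length give isometries with orthogonal ranges, so the square is a scalar. Cross
    terms between different lengths need not be scalars; the gauge average removes them. *)
Lemma layer_sqr l xi : star (layer l xi) * layer l xi =
  (wsum l (fun mu => sqc (xi mu)))%:C%:A.
Proof.
elim: l xi => [|l IH] xi.
  rewrite /layer /= /Sword big_nil starZ star1 -scalerAl -scalerAr mul1r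
    scalerA.
  by congr (_ *: _); rewrite sqcE.
rewrite layerS /= star_sum mulr_suml rmorph_sum scaler_suml /=.
apply: eq_bigr => i _; rewrite star_mul mulr_sumr (bigD1 i) //= big1 => [|j ji].
  by rewrite addr0 -mulrA [star (S i) * _]mulrA relS.1 mul1r IH.
by rewrite -mulrA [star (S i) * _]mulrA cuntz_orthogonal 1?eq_sym // mul0r
  mulr0.
Qed.

Lemma Xvec_ext l m xi : supported 0 l xi -> (l <= m)%N -> Xvec m xi = Xvec l xi.
Proof.
move=> s lm; rewrite /Xvec -(subnKC lm) big_split_ord /= [X in _ + X]big1
  ?addr0 //.
move=> i _; apply: layer0 => mu smu; apply: s; rewrite smu /= -leqNgt.
exact: leq_addr.
Qed.

Lemma nrm2_ext l m xi : supported 0 l xi -> (l <= m)%N -> nrm2 m xi = nrm2 l xi.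
Proof.
move=> s lm; rewrite /nrm2 -(subnKC lm) big_split_ord /= [X in _ + X]big1
  ?addr0 //.
move=> i _; apply: wsum0 => mu smu; rewrite s ?smu /= -?leqNgt ?leq_addr //.
by rewrite /sqc /= expr0n addr0.
Qed.

(** The vacuum coordinate is excluded because annihilation kills the vacuum, whereas
    [star (S i) * 1] is not 0 in [A]. *)
Lemma Xvec_letter l e xi : supported 1 l xi ->
  ev_letter S e * Xvec l xi = Xvec l.+1 (fock_letter e xi).
Proof.
move=> sxi; case: e => i [] /=; rewrite /ev_letter /=.
  rewrite /Xvec big_ord_recl layer0 ?add0r => [|mu /size0nil -> //].
  rewrite mulr_sumr; apply: eq_bigr => m _; rewrite layerS.
  rewrite (bigD1 i) //= big1 => [|j /negPf ji]; last first.
    by rewrite layer0 ?mulr0 // => mu _; rewrite /fock_letter /= ji.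
  rewrite addr0; congr (_ * _); apply: eq_wsum => mu _.
  by rewrite /fock_letter /= eqxx.
have sfx : supported 0 l.-1 (fock_letter (i, false) xi).
  move=> mu mul; apply: sxi; apply: contra mul => /=.
  by case: (l).
rewrite (Xvec_ext sfx) ?(leq_trans (leq_pred l)) //.
case: l sxi {sfx} => [|l] sxi; first by rewrite /Xvec !big_ord0 mulr0.
rewrite /Xvec big_ord_recl layer0 ?add0r => [|mu /size0nil ->]; last first.
  by apply: sxi.
rewrite mulr_sumr; apply: eq_bigr => m _; rewrite layerS mulr_sumr.
rewrite (bigD1 i) //= big1 => [|j ji].
  by rewrite addr0 mulrA relS.1 mul1r.
by rewrite mulrA cuntz_orthogonal 1?eq_sym // mul0r.
Qed.

Lemma Xvec_word l w xi : supported (size w) l xi ->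
  ev_word S w * Xvec l xi = Xvec (l + size w) (fock_word w xi).
Proof.
elim: w => [|e w IH] sxi /=; first by rewrite /ev_word big_nil mul1r addn0.
rewrite /ev_word big_cons -mulrA -/(ev_word S w) IH; last first.
  by apply: supportedW sxi => /=.
rewrite Xvec_letter ?addnS //.
by apply: (@supported_word _ _ 1); rewrite add1n.
Qed.

Lemma Xvec_poly D l p xi : (ncdeg p <= D)%N -> supported D l xi ->
  ev S p * Xvec l xi = Xvec (l + D) (fock_poly p xi).
Proof.
move=> pD sxi.
have -> : Xvec (l + D) (fock_poly p xi) =
    \sum_(t <- p) t.1 *: Xvec (l + D) (fock_word t.2 xi).
  rewrite /Xvec; under [RHS]eq_bigr do rewrite scaler_sumr.
  rewrite exchange_big /=; apply: eq_bigr => m _.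
  have lay t : t.1 *: layer m (fock_word t.2 xi) =
      wsum m (fun mu => t.1 *: (fock_word t.2 xi mu *: Sword S mu)).
    by apply: wsum_morph => [|x y]; rewrite ?scaler0 ?scalerDr.
  under [RHS]eq_bigr do rewrite lay.
  rewrite -wsum_sum; apply: eq_wsum => mu _ /=.
  by rewrite /fock_poly scaler_suml; apply: eq_bigr => t _; rewrite scalerA.
rewrite /ev mulr_suml; apply: eq_big_seq => t tp.
have tD := leq_trans (size_ncdeg tp) pD.
have st : supported (size t.2) l xi by apply: supportedW sxi.
rewrite -scalerAl Xvec_word //; congr (_ *: _).
by apply/esym/Xvec_ext; [exact: supported_word | rewrite leq_add2l].
Qed.

(** Right multiplication appends a letter. It commutes with the action of polynomials on the left
    and pushes vectors away from the vacuum. *)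
Lemma Xvec_mulr a l i xi : supported a l xi ->
  exists2 eta, Xvec l xi * S i = Xvec l.+1 eta & supported a.+1 l.+1 eta.
Proof.
(* The last letter is read through [rev]; words not ending in [i] get 0. *)
move=> sxi; pose eta : fock := fun mu => if rev mu is j :: nu then
  if j == i then xi (rev nu) else 0 else 0.
have etaE mu j : eta (rcons mu j) = if j == i then xi mu else 0.
  by rewrite /eta rev_rcons revK.
exists eta; last first.
  move=> mu; elim/last_ind: mu => [//|mu j _] mul; rewrite etaE.
  by case: eqP => // _; apply: sxi; rewrite size_rcons !ltnS in mul.
rewrite /Xvec big_ord_recl layer0 ?add0r => [|mu /size0nil -> //].
rewrite mulr_suml; apply: eq_bigr => m _;
  rewrite /layer -[nat_of_ord (lift ord0 m)]/(m.+1).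
rewrite wsum_rcons (bigD1 i) //= [X in _ + X]big1 => [|j /negPf ji]; last first.
  by apply: wsum0 => mu _; rewrite etaE ji scale0r.
rewrite addr0 (wsum_morph (f := fun x => x * S i)) ?mul0r //; last first.
  by move=> x y; rewrite mulrDl.
apply: eq_wsum => mu _; rewrite etaE eqxx -scalerAl; congr (_ *: _).
by rewrite /Sword -cats1 big_cat big_seq1.
Qed.

Lemma Xvec_mulrX a l i xi k : supported a l xi ->
  exists2 eta, Xvec l xi * S i ^+ k = Xvec (l + k) eta &
    supported (a + k) (l + k) eta.
Proof.
move=> sxi; elim: k => [|k [eta Xk seta]].
  by exists xi; rewrite ?expr0 ?mulr1 ?addn0.
rewrite exprSr mulrA Xk !addnS; exact: Xvec_mulr.
Qed.

Lemma gamma_layer (gamma : {lrmorphism A -> A}) (z : R[i]) l xi :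
  (forall i, gamma (S i) = z *: S i) ->
    gamma (layer l xi) = z ^+ l *: layer l xi.
Proof.
move=> gS; elim: l xi => [|l IH] xi.
  by rewrite /layer /= /Sword big_nil linearZ /= rmorph1 expr0 scale1r.
rewrite layerS rmorph_sum scaler_sumr; apply: eq_bigr => i _.
by rewrite rmorphM /= gS IH -scalerAl -scalerAr scalerA exprS.
Qed.

End Vectors.

(** * Averaging over the gauge action *)

(** As [m] is nonzero in [F], the polynomial [X^m - 1] is separable and has [m] distinct roots. *)
Lemma closed_prim_root_exists (F : closedFieldType) m : (0 < m)%N ->
  m%:R != 0 :> F -> exists z : F, m.-primitive_root z.
Proof.
move=> m0 mF; have [rs rsE] := closed_field_poly_normal ('X^m - 1 : {poly F}).
have {}rsE : 'X^m - 1 = \prod_(z <- rs) ('X - z%:P).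
  by rewrite [LHS]rsE (monicP (monicXnsubC 1 m0)) scale1r.
have : has m.-primitive_root rs.
  apply: has_prim_root => //.
  - by apply/allP => z zrs; rewrite /root_of_unity rsE root_prod_XsubC.
  - by rewrite -separable_prod_XsubC -rsE separable_Xn_sub_1.
  - by rewrite -ltnS -(size_prod_XsubC rs id) -rsE size_XnsubC.
by move=> /hasP [z _ zm]; exists z.
Qed.

Lemma prim_root_sum (F : fieldType) (z : F) m a b : m.-primitive_root z ->
  (a < m)%N -> (b < m)%N ->
  \sum_(j < m) (z ^+ j) ^+ a / (z ^+ j) ^+ b = if a == b then m%:R else 0.
Proof.
move=> zm am bm; have z0 : z != 0.
  apply/eqP => z0; have := prim_expr_order zm.
  by rewrite z0 expr0n gtn_eqF ?(prim_order_gt0 zm) // => /eqP;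
    rewrite eq_sym oner_eq0.
have -> : \sum_(j < m) (z ^+ j) ^+ a / (z ^+ j) ^+ b =
    \sum_(j < m) (z ^+ a / z ^+ b) ^+ j.
  by apply: eq_bigr => j _; rewrite expr_div_n -!exprM ![(j * _)%N]mulnC.
have [->|ab] := eqVneq a b.
  rewrite divff ?expf_neq0 // -[in RHS](card_ord m) -sumr_const.
  by apply: eq_bigr => j _; rewrite expr1n.
apply/eqP; have u1 : z ^+ a / z ^+ b - 1 != 0.
  rewrite subr_eq0; apply: contra ab => /eqP H.
  have /eqP : z ^+ a = z ^+ b by rewrite -[LHS](divfK (expf_neq0 b z0)) H mul1r.
  by rewrite (eq_prim_root_expr zm) !modn_small.
rewrite -(mulrI_eq0 _ (mulfI u1)) -subrX1 expr_div_n -!exprM ![(_ * m)%N]mulnC.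
by rewrite !exprM (prim_expr_order zm) !expr1n divr1 subrr.
Qed.

Section Averaging.
Variables (R : realType) (A : cstarAlgType R) (n : nat) (S : 'I_n -> A).
Hypothesis relS : cuntz_relations S.
Variable gamma : R[i] -> {lrmorphism A -> A}.
Hypothesis gammaS : is_gauge_action S gamma.
Local Notation fock := (seq 'I_n -> R[i]^o).
Implicit Types (xi eta : fock) (p q : ncpoly R n).

Lemma unity_norm (z : R[i]) m : (0 < m)%N -> z ^+ m = 1 -> `|z| = 1.
Proof.
move=> m0 zm; have : `|z| ^+ m = 1 by rewrite -normrX zm normr1.
by move/eqP; rewrite pexpr_eq1 // => /eqP.
Qed.

Lemma norm1_conj (z : R[i]) : `|z| = 1 -> (z^*)%C = z^-1.
Proof.
by move=> z1; rewrite invc_norm z1 expr1n invr1 mul1r.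
Qed.

(** The cross term of lengths [a] and [b] is scaled by the character of degree [b - a]. As both
    lengths are below [m], averaging over the [m]-th roots of unity kills it exactly unless [a = b],
    so a finite sum replaces the integral over the circle. The phase of [S i ^+ k] cancels. *)
Lemma average_sqr (z : R[i]) m l k i xi : m.-primitive_root z -> (l <= m)%N ->
  let Y := Xvec S l xi * S i ^+ k in
  \sum_(j < m) gamma (z ^+ j) (star Y * Y) = (m%:R * nrm2 l xi)%:C%:A.
Proof.
move=> zm lm Y; have m0 := prim_order_gt0 zm.
have zj (j : 'I_m) : `|z ^+ j| = 1.
  by rewrite normrX (unity_norm m0 (prim_expr_order zm)) expr1n.
pose s := S i ^+ k; have ss : star s * s = 1.
  rewrite /s; elim: (k) => [|k' IH]; first by rewrite expr0 star1 mulr1.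
  by rewrite exprSr star_mul -mulrA [star (_ ^+ _) * _]mulrA IH mul1r relS.1.
have gs w : `|w| = 1 -> gamma w s = w ^+ k *: s.
  move=> w1; rewrite rmorphXn /= (gammaS w1).2 exprZn //.
have gY w : `|w| = 1 -> gamma w Y = w ^+ k *: ((\sum_(a < l) w ^+ a *: layer S
  a xi) * s).
  move=> w1; rewrite rmorphM /= gs // -scalerAr; congr (_ *: (_ * _)).
  rewrite rmorph_sum; apply: eq_bigr => a _.
  by apply: gamma_layer; exact: (gammaS w1).2.
have gYY w : `|w| = 1 -> gamma w (star Y * Y) =
    \sum_(a < l) \sum_(b < l)
      (w ^+ b / w ^+ a) *: (star s * (star (layer S a xi) * layer S b xi) * s).
  move=> w1; rewrite rmorphM /= (gammaS w1).1 gY // starZ -scalerAl -scalerAr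
    scalerA.
  rewrite star_mul star_sum -[RHS]scale1r; congr (_ *: _).
    rewrite -[(_^*)%R]/(_^*)%C rmorphXn /= norm1_conj // -exprMn mulVf ?expr1n
      //.
    by rewrite -normr_eq0 w1 oner_eq0.
  rewrite mulrA -[star s * _ * _]mulrA mulr_suml mulr_sumr mulr_suml.
  apply: eq_bigr => a _; rewrite mulr_sumr mulr_sumr mulr_suml.
  apply: eq_bigr => b _; rewrite starZ -[(_^*)%R]/(_^*)%C rmorphXn /=
    norm1_conj //.
  rewrite -!scalerAl -!scalerAr -!scalerAl scalerA exprVn mulrC //.
transitivity (\sum_(a < l) \sum_(b < l) (if a == b then m%:R else 0) *:
    (star s * (star (layer S a xi) * layer S b xi) * s)).
  under eq_bigr => j _ do rewrite gYY //.
  rewrite exchange_big /=; apply: eq_bigr => a _.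
  rewrite exchange_big /=; apply: eq_bigr => b _.
  rewrite -scaler_suml (prim_root_sum zm) ?(leq_trans (ltn_ord _)) //.
  by rewrite eq_sym.
rewrite /nrm2 mulr_sumr rmorph_sum scaler_suml /=; apply: eq_bigr => a _.
rewrite (bigD1 a) //= eqxx big1 => [|b /negPf ba];
  last by rewrite eq_sym ba scale0r.
rewrite addr0 layer_sqr // -scalerAr -scalerAl mulr1 ss scalerA.
by rewrite rmorphM /= rmorph_nat.
Qed.

Hypothesis genS : cstar_generated S.

(* [1 - y^* y = b^2] with [b] self-adjoint, and [b] is close to a polynomial
   [q]; averaging [(X s)^* (1 - y^* y - q^* q) (X s)] over the gauge action
   gives [|xi|^2 - |p xi|^2 - |q eta|^2], up to a small error.  The power [s]
   moves [xi] far enough from the vacuum for [q] to act as in the algebra. *)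
Lemma fock_poly_le (i : 'I_n) p D l xi : (ncdeg p <= D)%N -> supported D l xi ->
  nm (ev S p) < 1 -> nrm2 (l + D) (fock_poly p xi) <= nrm2 l xi.
Proof.
move=> pD sxi p1; have [b [sb bb]] := cstar_sqrt_gap p1.
apply/ler_addgt0Pr => e e0; set X := Xvec S l xi.
pose K := (nm b + nm b + 1) * (nm X ^+ 2 + 1).
have K0 : 0 < K.
  by rewrite mulr_gt0 // ltr_wpDl ?addr_ge0 ?exprn_ge0 ?nm_ge0.
(* The bound 1 keeps [nm (ev S q)] below [nm b + 1]; the bound [e / K] then makes the error of
   replacing [b] by [q], multiplied by [nm X ^+ 2], at most [e]. *)
pose d := Num.min 1 (e / K).
have d0 : 0 < d by rewrite lt_min ltr01 divr_gt0.
have [q qd] := ev_dense genS b d0.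
have bq : nm (b * b - star (ev S q) * ev S q) * nm X ^+ 2 <= e.
  have -> : b * b - star (ev S q) * ev S q =
      star (b - ev S q) * b + star (ev S q) * (b - ev S q).
    by rewrite starB sb mulrBl mulrBr addrA subrK.
  have nq : nm (ev S q) <= nm b + 1.
    rewrite -[ev S q](subrK b) addrC (le_trans (nmD _ _)) // lerD2l nmB.
    by rewrite (le_trans qd) // ge_min lexx.
  have dK : d * K <= e by rewrite -ler_pdivlMr // ge_min lexx orbT.
  have : nm (star (b - ev S q) * b + star (ev S q) * (b - ev S q)) <=
      d * (nm b + nm b + 1).
    apply: (le_trans (nmD _ _)).
    have := nmM (star (b - ev S q)) b; have := nmM (star (ev S q)) (b - ev S q).
    rewrite !nm_star.
    have : nm (b - ev S q) * nm b <= d * nm b by rewrite ler_wpM2r ?nm_ge0.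
    have : nm (ev S q) * nm (b - ev S q) <= (nm b + 1) * d.
      by rewrite ler_pM ?nm_ge0.
    lra.
  move=> H; apply: le_trans dK; rewrite /K [leRHS]mulrA.
  by rewrite ler_pM ?nm_ge0 ?exprn_ge0 ?nm_ge0 // lerDl.
pose D' := ncdeg q; pose s := S i ^+ D'.
have [eta XE seta] := Xvec_mulrX S i D' sxi.
(* Large enough for the three vectors [xi], [p xi] and [q eta] to be averaged with the same root of
   unity. *)
pose m := (l + D + D' + D').+1.
have m0 : m%:R != 0 :> R[i] by rewrite pnatr_eq0.
have [z zm] := closed_prim_root_exists (ltn0Sn _) m0.
have zj (j : 'I_m) : `|z ^+ j| = 1.
  by rewrite normrX (unity_norm (ltn0Sn _) (prim_expr_order zm)) expr1n.
have E2 : ev S p * X = Xvec S (l + D) (fock_poly p xi) by apply: Xvec_poly.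
have E3 : ev S q * (X * s) = Xvec S (l + D' + D') (fock_poly q eta).
  by rewrite XE; apply: Xvec_poly => //; apply: supportedW seta => //;
    rewrite leq_addl.
have lm : (l <= m)%N by rewrite /m; lia.
have lDm : (l + D <= m)%N by rewrite /m; lia.
have lqm : (l + D' + D' <= m)%N by rewrite /m; lia.
have T1 := average_sqr D' i xi zm lm.
have T2 := average_sqr D' i (fock_poly p xi) zm lDm.
have T3 := average_sqr 0 i (fock_poly q eta) zm lqm.
move: T1 T2 T3; cbv zeta; rewrite expr0 mulr1 -E2 -E3 -/X -/s => T1 T2 T3.
set N1 := nrm2 l xi in T1 *; set N2 := nrm2 (l + D) _ in T2 *.
set N3 := nrm2 _ _ in T3.
pose Y := star (X * s) * (b * b - star (ev S q) * ev S q) * (X * s).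
have T : \sum_(j < m) gamma (z ^+ j) Y = (m%:R * (N1 - N2 - N3))%:C%:A.
  rewrite !mulrBr !rmorphB !scalerBl -T1 -T2 -T3 -!sumrB; apply: eq_bigr => j _.
  rewrite -!rmorphB; congr (gamma _ _).
  by rewrite /Y bb !mulrBr !mulrBl mulr1 !star_mul !mulrA.
have nY : nm Y <= e.
  apply: (le_trans (nmM _ _)).
  have nXs : nm (X * s) <= nm X.
    apply: (le_trans (nmM _ _)); rewrite -[leRHS]mulr1 ler_wpM2l ?nm_ge0 //.
    rewrite /s; elim: (D') => [|k IH]; first by rewrite expr0 nm1.
    rewrite exprS (le_trans (nmM _ _)) // -[leRHS]mulr1.
    by rewrite ler_pM ?nm_ge0 // isometry_le1.
  apply: le_trans bq; rewrite expr2 mulrA ler_pM ?nm_ge0 //.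
  by rewrite (le_trans (nmM _ _)) // mulrC nm_star ler_wpM2l ?nm_ge0.
have : nm (\sum_(j < m) gamma (z ^+ j) Y) <= m%:R * e.
  apply: (le_trans (nm_sum _ _ _)).
  rewrite -[m in m%:R]card_ord mulr_natl -sumr_const; apply: ler_sum => j _.
  rewrite (le_trans _ nY) //; apply: star_morphism_contractive.
  exact: (gammaS (zj j)).1.
rewrite T nmZR nm1 mulr1 normrM normr_nat ler_pM2l ?ltr0n // =>
  /ler_normlP [H _].
have : 0 <= N3 := nrm2_ge0 _ _; lra.
Qed.

End Averaging.

(** * Homogeneous approximation *)

Section Homogeneous.
Variables (R : realType) (A : cstarAlgType R) (n : nat) (S : 'I_n -> A).
Hypothesis genS : cstar_generated S.
Variables (k : nat) (zeta : R[i]) (g : {lrmorphism A -> A}).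
Hypotheses (zeta_prim : k.-primitive_root zeta) (gstar : star_preserving g).
Hypothesis gS : forall i, g (S i) = zeta *: S i.

Lemma gauge_word w : g (ev_word S w) = weight zeta w *: ev_word S w.
Proof.
have k0 := prim_order_gt0 zeta_prim.
have z1 : `|zeta| = 1 := unity_norm k0 (prim_expr_order zeta_prim).
rewrite /weight; elim: w => [|e w IH].
  by rewrite /ev_word !big_nil rmorph1 scale1r.
rewrite /ev_word !big_cons -/(ev_word S w) rmorphM /= IH.
rewrite -scalerAr -scalerA [RHS]scalerA mulrC -scalerA; congr (_ *: _).
rewrite scalerAl; congr (_ * _); case: e => i [] //=;
  rewrite /ev_letter /letter_weight /=.
  exact: gS.
by rewrite gstar gS starZ -[(_^*)%R]/(_^*)%C norm1_conj.
Qed.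

Lemma weight_unity (w : seq (letter n)) : weight zeta w ^+ k = 1.
Proof.
rewrite /weight -prodrXl big1 // => -[i b] _; rewrite /letter_weight /=.
by case: b; rewrite ?exprVn (prim_expr_order zeta_prim) // invr1.
Qed.

(** The spectral projection [P] onto the [c]-eigenspace of [g] is an average of contractions. It
    fixes [v] and turns an approximating polynomial into the list of its monomials of weight [c]. *)
Lemma homogeneous_approx (c : R[i]) v : c ^+ k = 1 -> g v = c *: v ->
  forall e : R, 0 < e ->
  exists p : ncpoly R n,
    (forall t, t \in p -> weight zeta t.2 = c) /\ nm (v - ev S p) <= e.
Proof.
move=> ck gv e e0; have k0 := prim_order_gt0 zeta_prim.
have kC : k%:R != 0 :> R[i] by rewrite pnatr_eq0 -lt0n.
have c0 : c != 0.
  by apply/eqP => c0; move: ck => /eqP;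
    rewrite c0 expr0n gtn_eqF // eq_sym oner_eq0.
have c1 : `|c^-1| = 1 by rewrite normfV (unity_norm k0 ck) invr1.
pose P x := k%:R^-1 *: \sum_(j < k) c^-1 ^+ j *: iter j g x.
have iterZ j a x : iter j g (a *: x) = a *: iter j g x.
  by elim: j => [|j IH] //=; rewrite IH linearZ.
have iterD j x y : iter j g (x + y) = iter j g x + iter j g y.
  by elim: j => [|j IH] //=; rewrite IH raddfD.
have iterE j a x : g x = a *: x -> iter j g x = a ^+ j *: x.
  move=> gx; elim: j => [|j IH] /=; first by rewrite expr0 scale1r.
  by rewrite IH linearZ /= gx scalerA exprSr.
have PE a x : a ^+ k = 1 -> g x = a *: x -> P x = if a == c then x else 0.
  move=> ak gx; rewrite /P; under eq_bigr do rewrite (iterE _ _ _ gx) scalerA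
    -exprMn.
  rewrite -scaler_suml scalerA; have [->|ac] := eqVneq a c.
    rewrite mulVf //; under eq_bigr do rewrite expr1n.
    by rewrite sumr_const card_ord mulVf // scale1r.
  have u1 : c^-1 * a - 1 != 0.
    rewrite subr_eq0; apply: contra ac => /eqP H.
    by rewrite -[a](mulVKf c0) H mulr1.
  have -> : \sum_(i < k) (c^-1 * a) ^+ i = 0.
    apply: (mulfI u1); rewrite -subrX1 mulr0 exprMn ak exprVn ck.
    by rewrite invr1 mulr1 subrr.
  by rewrite mulr0 scale0r.
have PD x y : P (x + y) = P x + P y.
  rewrite /P -scalerDr -big_split; congr (_ *: _); apply: eq_bigr => j _.
  by rewrite iterD scalerDr.
have PZ a x : P (a *: x) = a *: P x.
  rewrite /P scalerA mulrC -scalerA; congr (_ *: _); rewrite scaler_sumr.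
  by apply: eq_bigr => j _; rewrite iterZ !scalerA mulrC.
have P0 : P 0 = 0 by have := PZ 0 0; rewrite !scale0r.
have Ple x : nm (P x) <= nm x.
  rewrite nmZ normfV normr_nat.
  have -> : complex.Re (k%:R^-1 : R[i]) = k%:R^-1.
    by rewrite -(rmorph_nat (real_complex R)) -fmorphV.
  rewrite mulrC ler_pdivrMr ?ltr0n //; apply: (le_trans (nm_sum _ _ _)).
  rewrite -[k in k%:R]card_ord mulr_natr -sumr_const; apply: ler_sum => j _.
  rewrite nmZ normrX c1 expr1n mul1r; elim: (val j) => [|i IH] //=.
  exact: le_trans (star_morphism_contractive gstar _) IH.
have [p vp] := ev_dense genS v e0.
exists [seq t <- p | weight zeta t.2 == c]; split.
  by move=> t; rewrite mem_filter => /andP[/eqP].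
have -> : ev S [seq t <- p | weight zeta t.2 == c] = P (ev S p).
  rewrite /ev (big_morph P PD P0) big_filter big_mkcond; apply: eq_bigr => t _.
  rewrite PZ (PE _ _ (weight_unity _) (gauge_word _)).
  by case: eqP; rewrite ?scaler0.
have {1}-> : v = P v by rewrite (PE c v ck gv) eqxx.
by rewrite -scaleN1r -PZ -PD scaleN1r; exact: le_trans (Ple _) vp.
Qed.

End Homogeneous.

(** * Square-summable vectors *)

Section SquareSummable.
Variables (R : realType) (n : nat).
Local Notation fock := (seq 'I_n -> R[i]^o).
Implicit Types (xi eta : fock) (mu : seq 'I_n) (p q : ncpoly R n).

Lemma sqcD (a b : R[i]) : sqc (a + b) <= 2 * sqc a + 2 * sqc b.
Proof. by case: a b => a1 a2 [b1 b2]; rewrite /sqc /=;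
  have := sqr_ge0 (a1 - b1);
  have := sqr_ge0 (a2 - b2); nra. Qed.

Lemma sqcM (a b : R[i]) : sqc (a * b) = sqc a * sqc b.
Proof. by case: a b => a1 a2 [b1 b2]; rewrite /sqc /=; ring. Qed.

Lemma sqcN (a : R[i]) : sqc (- a) = sqc a.
Proof. by rewrite -mulN1r sqcM /sqc /= oppr0 sqrrN expr1n expr0n addr0 mul1r.
  Qed.

Lemma sqc_eq0 (a : R[i]) : sqc a <= 0 -> a = 0.
Proof.
case: a => a b; rewrite /sqc /= => ab; have := sqr_ge0 a; have := sqr_ge0 b.
move=> b0 a0; have /eqP -> : a == 0 by rewrite -sqrf_eq0; apply/eqP; lra.
by have /eqP -> : b == 0 by rewrite -sqrf_eq0; apply/eqP; lra.
Qed.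

Lemma nrm2_le l xi eta : (forall mu, (size mu < l)%N ->
  sqc (xi mu) <= sqc (eta mu)) ->
  nrm2 l xi <= nrm2 l eta.
Proof.
by move=> H; apply: ler_sum => m _; apply: wsum_le => mu smu; apply: H;
  rewrite smu.
Qed.

Lemma nrm2_eq l xi eta : (forall mu, (size mu < l)%N -> xi mu = eta mu) ->
  nrm2 l xi = nrm2 l eta.
Proof.
by move=> H; apply: eq_bigr => m _; apply: eq_wsum => mu smu; rewrite H ?smu.
Qed.

Lemma nrm2_mono l m xi : (l <= m)%N -> nrm2 l xi <= nrm2 m xi.
Proof.
move=> lm; rewrite /nrm2 -(subnKC lm) big_split_ord /= lerDl sumr_ge0 // => i _.
by apply: wsum_ge0 => mu; exact: sqc_ge0.
Qed.

Lemma wsumZ l (c : R) (g : seq 'I_n -> R) : wsum l (fun mu =>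
  c * g mu) = c * wsum l g.
Proof.
by apply/esym/(wsum_morph (f := fun x => c * x));
  [rewrite mulr0 | exact: mulrDr].
Qed.

Lemma nrm2D l xi eta : nrm2 l (xi + eta) <= 2 * nrm2 l xi + 2 * nrm2 l eta.
Proof.
rewrite /nrm2 !mulr_sumr -big_split; apply: ler_sum => m _ /=.
by rewrite -!wsumZ -wsumD; apply: wsum_le => mu _; rewrite !fctE sqcD.
Qed.

Lemma nrm2Z l c xi : nrm2 l (c *: xi) = sqc c * nrm2 l xi.
Proof.
rewrite /nrm2 !mulr_sumr; apply: eq_bigr => m _.
by rewrite -wsumZ; apply: eq_wsum => mu _; rewrite !fctE -sqcM.
Qed.

Lemma nrm2N l xi : nrm2 l (- xi) = nrm2 l xi.
Proof.
by apply: eq_bigr => m _; apply: eq_wsum => mu _; rewrite !fctE sqcN.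
Qed.

Lemma nrm2_ge_term mu xi : sqc (xi mu) <= nrm2 (size mu).+1 xi.
Proof.
rewrite /nrm2 big_ord_recr /= (le_trans (wsum_ge_term (g := fun mu =>
  sqc (xi mu)) mu _)).
- by [].
- by move=> nu; exact: sqc_ge0.
by rewrite lerDr sumr_ge0 // => i _; apply: wsum_ge0 => nu; exact: sqc_ge0.
Qed.

Definition l2 xi := exists C : R, forall l, nrm2 l xi <= C.

Lemma l2D xi eta : l2 xi -> l2 eta -> l2 (xi + eta).
Proof.
move=> [C HC] [C' HC']; exists (2 * C + 2 * C') => l.
apply: (le_trans (nrm2D _ _ _)); have := HC l; have := HC' l; lra.
Qed.

Lemma l2Z c xi : l2 xi -> l2 (c *: xi).
Proof.
move=> [C HC]; exists (sqc c * C) => l; rewrite nrm2Z ler_wpM2l ?HC //.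
exact: sqc_ge0.
Qed.

Lemma l2_0 : l2 0.
Proof.
exists 0 => l; rewrite /nrm2 big1 // => m _; apply: wsum0 => mu _.
by rewrite /sqc /= expr0n addr0.
Qed.

Lemma l2_letter e xi : l2 xi -> l2 (fock_letter e xi).
Proof.
move=> [C HC]; exists C => l; apply: le_trans (HC l.+1); case: e => i [].
  apply: (@le_trans _ _ (nrm2 l.+1 (fock_letter (i, true) xi)));
    first exact: nrm2_mono.
  rewrite /nrm2 big_ord_recl /= {1}/fock_letter /= {1}/sqc /= expr0n addr0
    add0r.
  apply: (@le_trans _ _ (nrm2 l xi)); last exact: nrm2_mono.
  apply: ler_sum => m _ /=; rewrite (bigD1 i) //= big1 => [|j /negPf ji].
    by rewrite addr0; apply: wsum_le => mu _; rewrite /fock_letter /= eqxx.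
  by apply: wsum0 => mu _; rewrite /fock_letter /= ji /sqc /= expr0n addr0.
rewrite /nrm2 [leRHS]big_ord_recl /= -[leLHS]add0r lerD ?sqc_ge0 //.
apply: ler_sum => m _ /=; rewrite (bigD1 i) //= lerDl sumr_ge0 // => j _.
by apply: wsum_ge0 => mu; exact: sqc_ge0.
Qed.

Lemma l2_word w xi : l2 xi -> l2 (fock_word w xi).
Proof. by move=> xi2; elim: w => [|e w IH] //=; exact: l2_letter. Qed.

Lemma l2_poly p xi : l2 xi -> l2 (fock_poly p xi).
Proof.
move=> xi2; elim: p => [|t p IH].
  have -> : fock_poly [::] xi = 0.
    by apply/funext => mu; rewrite /fock_poly big_nil.
  exact: l2_0.
have -> : fock_poly (t :: p) xi = t.1 *: fock_word t.2 xi + fock_poly p xi.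
  by apply/funext => mu; rewrite !fctE /fock_poly big_cons.
by apply: l2D => //; apply/l2Z/l2_word.
Qed.

Lemma l2_le xi eta : (forall mu, sqc (xi mu) <= sqc (eta mu)) -> l2 eta ->
  l2 xi.
Proof.
by move=> H [C HC]; exists C => l; apply: le_trans (HC l);
  apply: nrm2_le => mu _.
Qed.

Definition cut_below D xi : fock := fun mu =>
  if (size mu < D)%N then 0 else xi mu.

Lemma cut_below_linear D : linear (cut_below D).
Proof.
move=> a xi eta; apply/funext => mu; rewrite !fctE /cut_below.
by case: ifP => // _; rewrite scaler0 addr0.
Qed.

(** Pointwise convergence is enough here: each coordinate of a polynomial image depends on finitely
    many coordinates, and uniform bounds on truncated norms, being finite sums, pass to the
    limit. *)
Definition ptcvg (u : nat -> fock) xi := forall mu,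
  complex.Re (u j mu) @[j --> \oo] --> complex.Re (xi mu) /\
  complex.Im (u j mu) @[j --> \oo] --> complex.Im (xi mu).

Lemma ptcvg_word u xi w : ptcvg u xi -> ptcvg (fun j =>
  fock_word w (u j)) (fock_word w xi).
Proof.
move=> uxi; elim: w => [|[i b] w IH] //= mu; rewrite /fock_letter /=.
case: b => //; case: mu => [|j mu]; first by split; exact: cvg_cst.
by case: eqP => _ //; split; exact: cvg_cst.
Qed.

Lemma ReM (a b : R[i]) : complex.Re (a * b) =
  complex.Re a * complex.Re b - complex.Im a * complex.Im b.
Proof. by case: a b => ? ? []. Qed.

Lemma ImM (a b : R[i]) : complex.Im (a * b) =
  complex.Re a * complex.Im b + complex.Im a * complex.Re b.
Proof. by case: a b => ? ? []. Qed.

Lemma ptcvg_poly u xi p : ptcvg u xi -> ptcvg (fun j =>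
  fock_poly p (u j)) (fock_poly p xi).
Proof.
move=> uxi mu; elim: p => [|t p [IH1 IH2]].
  by rewrite /fock_poly !big_nil; under eq_cvg do rewrite big_nil;
     split; [exact: cvg_cst | under eq_cvg do rewrite big_nil; exact: cvg_cst].
have [w1 w2] := ptcvg_word t.2 uxi mu.
rewrite /fock_poly big_cons -/(fock_poly p xi mu); split.
  under eq_cvg do rewrite big_cons raddfD /= ReM.
  rewrite raddfD /= ReM; apply: cvgD => //.
  by apply: cvgB; apply: cvgM => //; exact: cvg_cst.
under eq_cvg do rewrite big_cons raddfD /= ImM.
rewrite raddfD /= ImM; apply: cvgD => //.
by apply: cvgD; apply: cvgM => //; exact: cvg_cst.
Qed.

Lemma ptcvg_unique u xi eta : ptcvg u xi -> ptcvg u eta -> xi = eta.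
Proof.
move=> h1 h2; apply/funext => mu; have [r1 i1] := h1 mu; have [r2 i2] := h2 mu.
apply/eqP; rewrite eq_complex (cvg_unique _ r1 r2) // (cvg_unique _ i1 i2) //.
by rewrite !eqxx.
Qed.

Lemma cvg_wsum l (g : nat -> seq 'I_n -> R) h :
  (forall mu, g j mu @[j --> \oo] --> h mu) ->
  wsum l (g j) @[j --> \oo] --> wsum l h.
Proof.
elim: l g h => [|l IH] g h gh /=; first exact: gh.
by apply: cvg_big => [|i _]; [exact: add_continuous | exact: IH].
Qed.

Lemma ptcvg_nrm2 u xi l (C : R) : ptcvg u xi -> (forall j, nrm2 l (u j) <= C) ->
  nrm2 l xi <= C.
Proof.
move=> uxi uC; have cv : nrm2 l (u j) @[j --> \oo] --> nrm2 l xi.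
  apply: cvg_big => [|m _]; first exact: add_continuous.
  apply: cvg_wsum => mu; have [r i] := uxi mu.
  by rewrite /sqc; apply: cvgD; rewrite expr2; under eq_cvg do rewrite expr2;
    exact: cvgM.
rewrite -(cvg_lim _ cv) //; apply: limr_le; first by apply/cvg_ex; eexists;
  exact: cv.
by apply: nearW.
Qed.

End SquareSummable.

(** * Inverting a perturbation of the identity that is small away from the vacuum *)

Section Neumann.
Variables (R : realType) (n : nat) (y : ncpoly R n) (D : nat).
Local Notation fock := (seq 'I_n -> R[i]^o).
Implicit Types (xi eta : fock) (mu : seq 'I_n).
Hypothesis yD : (ncdeg y <= D)%N.
(* [16^-1] leaves room for the factor 2 in [nrm2D]. *)
Hypothesis y_small : forall l xi, supported D l xi ->
  nrm2 (l + D) (fock_poly y xi) <= 16^-1 * nrm2 l xi.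

Definition deep xi := fock_poly y (cut_below D xi).

Lemma deep_linear : linear deep.
Proof. by move=> a xi eta; rewrite /deep cut_below_linear fock_poly_linear. Qed.

(** Coordinates of length below [l] depend only on input of length below [l + D], so [xi] may be
    replaced by a finitely supported vector that avoids words shorter than [D]. *)
Lemma deep_le l xi : nrm2 l (deep xi) <= 16^-1 * nrm2 (l + D) xi.
Proof.
pose xi' : fock := fun mu => if (D <= size mu < l + D)%N then xi mu else 0.
have sxi' : supported D (l + D) xi' by move=> mu /negPf mul; rewrite /xi' mul.
have -> : nrm2 l (deep xi) = nrm2 l (fock_poly y xi').
  apply: nrm2_eq => mu mul; apply: (fock_poly_local yD) mul => nu nul.
  by rewrite /cut_below /xi' ltnNge nul andbT; case: leqP.
apply: le_trans (nrm2_mono _ (leq_addr (D + D) l)) _; rewrite addnA.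
apply: (le_trans (y_small sxi')); rewrite ler_wpM2l ?invr_ge0 //.
apply: nrm2_le => mu _; rewrite /xi'; case: ifP => // _.
by rewrite {1}/sqc /= expr0n addr0 sqc_ge0.
Qed.

(** Each substitution of [- deep xi] for [xi] gains a factor 1/16. It also enlarges the truncation
    by [D], which is harmless because the [l2] bound is uniform in the truncation. *)
Lemma deep_injective xi : l2 xi -> xi + deep xi = 0 -> xi = 0.
Proof.
move=> [C HC] /eqP; rewrite addr_eq0 => /eqP xiE.
have small j l : nrm2 l xi <= C * 16^-1 ^+ j.
  elim: j l => [|j IH] l; first by rewrite expr0 mulr1.
  rewrite xiE nrm2N exprS mulrCA; apply: (le_trans (deep_le _ _)).
  by rewrite ler_wpM2l ?invr_ge0.
apply/funext => mu; apply: sqc_eq0; apply: (le_trans (nrm2_ge_term mu xi)).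
apply/ler_addgt0Pr => e e0; rewrite add0r.
have r01 : 0 <= (16^-1 : R) < 1 by lra.
have [N /(_ _ (leqnn N)) HN] := geometric_small C r01 e0.
exact: le_trans (small N _) HN.
Qed.

Lemma deep_surjective eta : l2 eta -> exists2 xi, l2 xi & xi + deep xi = eta.
Proof.
move=> [C HC]; have C0 : 0 <= C := le_trans (nrm2_ge0 0 eta) (HC 0).
pose s j := iter j (fun xi => eta - deep xi) 0.
have sS j : s j.+1 = eta - deep (s j) by [].
have deepB xi xi' : deep (xi - xi') = deep xi - deep xi'.
  by rewrite addrC -scaleN1r deep_linear scaleN1r addrC.
have deep0 : deep 0 = 0 by have := deepB 0 0; rewrite !subrr.
have stepB a b : (eta - deep a) - (eta - deep b) = - deep (a - b).
  by rewrite deepB !opprB addrC addrA subrK.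
have ds j l : nrm2 l (s j.+1 - s j) <= C * 16^-1 ^+ j.
  elim: j l => [|j IH] l.
    by rewrite sS /= deep0 !subr0 expr0 mulr1.
  rewrite [X in nrm2 _ X](stepB (s j.+1) (s j)) nrm2N exprS mulrCA.
  by apply: (le_trans (deep_le _ _)); rewrite ler_wpM2l ?invr_ge0.
(* A bound [K] is preserved by the recursion once [2 * C + K / 8 <= K]; [4 * C] is such a value. *)
have sb j l : nrm2 l (s j) <= 4 * C.
  elim: j l => [|j IH] l.
    rewrite /s /= /nrm2 big1 ?mulr_ge0 // => m _; apply: wsum0 => mu _.
    by rewrite /sqc /= expr0n addr0.
  rewrite sS; apply: (le_trans (nrm2D _ _ _)); rewrite nrm2N.
  have := deep_le l (s j); have := HC l; have := IH (l + D)%N; lra.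
have cv (f : R[i] -> R) : {morph f : a b / a - b} ->
    (forall a, f a ^+ 2 <= sqc a) -> forall mu, cvgn (fun j => f (s j mu)).
  move=> fB fsq mu; set v := fun j => f (s j mu).
  suff : cvgn (series (telescope v)).
    rewrite telescopeK => /cvg_ex [a va]; apply/cvg_ex; exists (a + v 0%N).
    have {1}-> : v = (fun j => v j - v 0%N) + cst (v 0%N).
      by apply/funext => j; rewrite !fctE subrK.
    by apply: cvgD => //; exact: cvg_cst.
  apply: normed_cvg.
  (* Squared increments are at most [C * 16^-1 ^+ j]; since [C <= (C + 1) ^+ 2], the increments
     themselves are dominated by [(C + 1) * 4^-1 ^+ j]. *)
  apply: (@series_le_cvg _ _ (geometric (C + 1) 4^-1)).
  - by move=> j; rewrite normr_ge0.
  - by move=> j; rewrite /geometric /= mulr_ge0 ?addr_ge0 // exprn_ge0 //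
    invr_ge0.
  - move=> j; rewrite /geometric /= -(@ler_pXn2r _ 2) ?nnegrE ?normr_ge0 //;
    last first.
      by rewrite mulr_ge0 ?addr_ge0 // exprn_ge0 // invr_ge0.
    rewrite real_normK ?num_real // /telescope /v /= -fB (le_trans (fsq _)) //.
    rewrite -[s j.+1 mu - s j mu]/((s j.+1 - s j) mu) (le_trans (nrm2_ge_term _
      _)) //.
    rewrite (le_trans (ds j _)) // exprMn exprAC expr2.
    have -> : 4^-1 ^+ 2 = 16^-1 :> R by lra.
    rewrite ler_wpM2r ?exprn_ge0 ?invr_ge0 //; nra.
  - by apply: is_cvg_geometric_series;
    rewrite ger0_norm ?invr_ge0 // invf_lt1 // ltr1n.
pose xi : fock := fun mu =>
  (limn (fun j => complex.Re (s j mu)) +i* limn (fun j =>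
    complex.Im (s j mu)))%C.
have sxi : ptcvg s xi.
  move=> mu; split; apply: cv => [a b|[a b]]; rewrite ?raddfB //= /sqc /=.
    by rewrite lerDl sqr_ge0.
  by rewrite lerDr sqr_ge0.
exists xi; first by exists (4 * C) => l; apply: ptcvg_nrm2 sxi _.
have H1 : ptcvg (fun j => s j.+1) xi.
  by move=> mu; have [r i] := sxi mu; split;
    [rewrite -cvg_shiftS in r | rewrite -cvg_shiftS in i].
have H2 : ptcvg (fun j => s j.+1) (eta - deep xi).
  have cxi : ptcvg (fun j => cut_below D (s j)) (cut_below D xi).
    by move=> mu; rewrite /cut_below; case: ifP => _ //; split; exact: cvg_cst.
  move=> mu; have [r i] := ptcvg_poly y cxi mu.
  by split; under eq_cvg do rewrite sS !fctE raddfB /=; rewrite !fctE raddfB /=;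
    apply: cvgB => //; exact: cvg_cst.
by rewrite (ptcvg_unique H1 H2) {1}(ptcvg_unique H1 H2) subrK.
Qed.

End Neumann.

(** * Gauge sectors of the Fock space *)

Section Sectors.
Variables (R : realType) (n : nat).
Local Notation fock := (seq 'I_n -> R[i]^o).
Implicit Types (xi eta : fock) (mu : seq 'I_n) (zeta c : R[i]).

(** For [zeta] a primitive [k]-th root of unity and [c = zeta ^+ j], these are the square-summable
    vectors on words of length [j] mod [k]. Naming the sector by its gauge eigenvalue lets weights
    of polynomials multiply it directly. *)
Definition in_sector zeta c : {pred fock} :=
  fun xi => `[< l2 xi /\ forall mu, zeta ^+ size mu <> c -> xi mu = 0 >].

Lemma in_sectorP zeta c xi :
  reflect (l2 xi /\ forall mu, zeta ^+ size mu <> c -> xi mu = 0)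
    (xi \in in_sector zeta c).
Proof. exact: asboolP. Qed.

(** The support condition becomes an eigenvector equation, which passes through polynomials and
    through uniqueness arguments. *)
Lemma sector_twistP zeta c xi :
  (forall mu, zeta ^+ size mu <> c -> xi mu = 0) <-> twist zeta xi = c *: xi.
Proof.
split=> [xi0|txi mu zc].
  apply/funext => mu; rewrite fctE /twist.
  have [->//|zc] := pselect (zeta ^+ size mu = c).
  by rewrite xi0 // mulr0 scaler0.
have /eqP : twist zeta xi mu = (c *: xi) mu by rewrite txi.
rewrite fctE /twist -subr_eq0 -[c *: _]/(c * _) -mulrBl mulf_eq0 subr_eq0.
by case/orP => /eqP.
Qed.

Lemma in_sector_closed zeta c : submod_closed (in_sector zeta c).
Proof.
split; first by apply/in_sectorP; split=> //; exact: l2_0.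
move=> a xi eta /in_sectorP [xi2 xi0] /in_sectorP [eta2 eta0].
apply/in_sectorP; split; first by apply: l2D => //; exact: l2Z.
by move=> mu zc; rewrite !fctE xi0 // eta0 // scaler0 addr0.
Qed.

HB.instance Definition _ zeta c := GRing.isSubmodClosed.Build R[i] fock
  (in_sector zeta c) (in_sector_closed zeta c).

Record sector zeta c := Sector { sector_val :> fock;
  _ : sector_val \in in_sector zeta c }.

HB.instance Definition _ zeta c := [isSub for @sector_val zeta c].
HB.instance Definition _ zeta c := [Choice of sector zeta c by <:].
HB.instance Definition _ zeta c := [SubChoice_isSubLmodule of sector zeta c
  by <:].

Lemma sector_valP zeta c (v : sector zeta c) :
  l2 (v : fock) /\ forall mu, zeta ^+ size mu <> c -> (v : fock) mu = 0.
Proof. exact/in_sectorP/valP. Qed.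

Lemma sector_eqP zeta c (u v : sector zeta c) : (forall mu, u mu = v mu) ->
  u = v.
Proof. by move=> uv; apply: val_inj; apply/funext. Qed.

Lemma sector_polyP zeta c d (p : ncpoly R n) (v : sector zeta c) : zeta != 0 ->
  (forall t, t \in p -> weight zeta t.2 = d) ->
  fock_poly p v \in in_sector zeta (d * c).
Proof.
move=> z0 pd; have [v2 v0] := sector_valP v; apply/in_sectorP.
split; first exact: l2_poly.
apply: (sector_twistP _ _ _).2.
rewrite (twist_poly _ z0 pd) ((sector_twistP _ _ _).1 v0).
by rewrite (linear_funZ (@fock_poly_linear R n p)) scalerA.
Qed.

Definition sector_low zeta c D (v : sector zeta c) : {ffun D.-bseq 'I_n ->
  R[i]^o} :=
  [ffun b => (v : fock) (val b)].

Lemma sector_low_linear zeta c D : linear (@sector_low zeta c D).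
Proof. by move=> a u v; apply/ffunP => b; rewrite !ffunE. Qed.

(** The type [D.-bseq] also contains words of length exactly [D]; the strict guard ignores those
    coordinates, and the eigenvalue test keeps the result inside the sector. *)
Definition sector_ext_fun zeta c D (x : {ffun D.-bseq 'I_n -> R[i]^o}) : fock :=
  fun mu => if (size mu < D)%N && (zeta ^+ size mu == c) then
    if insub mu is Some b then x b else 0 else 0.

Lemma l2_finite D xi : supported 0 D xi -> l2 xi.
Proof.
move=> sxi; exists (nrm2 D xi) => l; have [lD|Dl] := leqP l D.
  exact: nrm2_mono.
by rewrite (nrm2_ext sxi) // ltnW.
Qed.

Lemma sector_extP zeta c D (x : {ffun D.-bseq 'I_n -> R[i]^o}) :
  sector_ext_fun zeta c x \in in_sector zeta c.
Proof.
apply/in_sectorP; split.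
  by apply: (@l2_finite D) => mu /=; rewrite /sector_ext_fun => /negPf ->.
by move=> mu /eqP/negPf zc; rewrite /sector_ext_fun zc andbF.
Qed.

Definition sector_ext zeta c D x := Sector (@sector_extP zeta c D x).

Lemma sector_ext_linear zeta c D : linear (@sector_ext zeta c D).
Proof.
move=> a x y; apply: sector_eqP => mu /=; rewrite !fctE /= /sector_ext_fun.
case: ifP => _; last by rewrite scaler0 addr0.
by case: insubP => [b _ _|_]; rewrite ?ffunE // scaler0 addr0.
Qed.

Lemma sector_ext_low zeta c D (v : sector zeta c) mu : (size mu < D)%N ->
  sector_ext zeta c (sector_low D v) mu = v mu.
Proof.
move=> muD; rewrite /= /sector_ext_fun muD /=.
have [_ v0] := sector_valP v; case: eqP => [_|/v0 -> //].
by case: insubP => [b _ <-|]; rewrite ?ffunE // ltnW.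
Qed.

End Sectors.

(** * Kernel and range of a polynomial between sectors *)

Section Fredholm.
Variables (R : realType) (n : nat) (zeta : R[i]).
Hypothesis z1 : `|zeta| = 1.
Let z0 : zeta != 0.
Proof. by rewrite -normr_eq0 z1 oner_eq0. Qed.
Local Notation fock := (seq 'I_n -> R[i]^o).
Local Notation sector := (sector n zeta).
Variables (p q : ncpoly R n) (d d' : R[i]).
Hypothesis pd : forall t, t \in p -> weight zeta t.2 = d.
Hypothesis qd : forall t, t \in q -> weight zeta t.2 = d'.
Hypothesis dd : d' * d = 1.
Variable D : nat.
Let y := ncmul q p ++ [:: (-1, [::])].
Hypothesis yD : (ncdeg y <= D)%N.
Hypothesis y_small : forall l (xi : fock), supported D l xi ->
  nrm2 (l + D) (fock_poly y xi) <= 16^-1 * nrm2 l xi.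

Lemma fock_defect (xi : fock) : fock_poly y xi = fock_poly q (fock_poly p xi) -
  xi.
Proof.
rewrite /y fock_poly_cat fock_poly_mul; congr (_ + _); apply/funext => mu.
by rewrite /fock_poly big_seq1 /= fctE mulN1r.
Qed.

(** Vanishing low coordinates give [cut_below D v = v], and [p v = 0] gives [y v = - v]; hence
    [v + deep v = 0]. *)
Lemma sector_poly_injective c (v : sector c) :
  fock_poly p v = 0 -> sector_low D v = 0 -> v = 0.
Proof.
move=> pv lv; apply/val_inj/(deep_injective yD y_small).
  exact: (sector_valP v).1.
have cv : cut_below D v = v.
  apply/funext => mu; rewrite /cut_below; case: ifP => // muD.
  rewrite -(sector_ext_low v muD) lv /= /sector_ext_fun.
  by case: ifP => // _; case: insubP => // b _ _; rewrite ffunE.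
by rewrite /deep cv fock_defect pv (linear_fun0 (@fock_poly_linear R n q))
  sub0r subrr.
Qed.

(** Solve [xi + deep xi = w]. As [deep] differs from [y] only by the action of [y] on the words of
    [xi] shorter than [D], [w] is [q p xi] minus [y] applied to that finite-dimensional part. *)
Lemma sector_poly_surjective c (w : sector c) : exists (w' : sector c) x,
  (w : fock) = fock_poly q (fock_poly p w') - fock_poly y (sector_ext zeta c (D
    := D) x).
Proof.
have [w2 w0] := sector_valP w.
have [xi xi2 xiE] := deep_surjective yD y_small w2.
have yd t : t \in y -> weight zeta t.2 = 1.
  rewrite mem_cat inE => /orP[/allpairsP [[s u] /= [sq up ->]]|/eqP ->] /=.
    by rewrite /weight big_cat -/(weight zeta s.2) (qd sq) -/(weight zeta u.2)
      (pd up).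
  by rewrite /weight big_nil.
(* Because [y] has weight 1, [twist zeta xi - c *: xi] solves the homogeneous equation, hence
   vanishes by injectivity; so the solution lies in the sector of [w]. *)
have sxi : xi \in in_sector zeta c.
  apply/in_sectorP; split=> //; apply: (sector_twistP _ _ _).2.
  have twc eta : twist zeta (cut_below D eta) = cut_below D (twist zeta eta).
    apply/funext => mu; rewrite /twist /cut_below; case: ifP => //;
      rewrite mulr0 //.
  have two : twist zeta (deep y D xi) = deep y D (twist zeta xi).
    by rewrite /deep (twist_poly _ z0 yd) scale1r twc.
  apply/eqP; rewrite -subr_eq0; apply/eqP/(deep_injective yD y_small).
    apply: l2D; last by rewrite -scaleN1r; do 2!apply: l2Z.
    apply: l2_le xi2 => mu; rewrite /twist sqcM.
    suff -> : sqc (zeta ^+ size mu) = 1 by rewrite mul1r.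
    apply: complexI; rewrite sqcE -normCKC normrX z1.
    by rewrite !expr1n.
  have dl := @deep_linear R n y D.
  have dB : deep y D (twist zeta xi - c *: xi) = twist zeta (deep y D xi) - c
    *: deep y D xi.
    by rewrite two (linear_funB dl) (linear_funZ dl).
  rewrite dB addrACA -opprD -scalerDr.
  have -> : twist zeta xi + twist zeta (deep y D xi) = twist zeta w.
    by rewrite -xiE; apply/funext => mu; rewrite !fctE /twist mulrDr.
  by rewrite xiE ((sector_twistP _ _ _).1 w0) subrr.
have low mu : (xi - cut_below D xi) mu = sector_ext zeta c (sector_low D
  (Sector sxi)) mu.
  rewrite !fctE /cut_below; case: ifP => muD;
    first by rewrite sector_ext_low // subr0.
  by rewrite subrr /= /sector_ext_fun muD.
exists (Sector sxi), (sector_low D (Sector sxi)).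
have -> : (sector_ext zeta c (sector_low D (Sector sxi)) : fock) = xi -
  cut_below D xi.
  by apply/funext => mu; rewrite low.
have -> : fock_poly q (fock_poly p (Sector sxi)) = fock_poly y xi + xi.
  by rewrite fock_defect subrK.
rewrite (linear_funB (@fock_poly_linear R n y)).
by rewrite opprB [_ + xi]addrC -addrA [fock_poly y xi + _]addrC subrK -[in
  LHS]xiE.
Qed.

End Fredholm.

(** * Splitting off the last [k] letters *)

Section Splitting.
Variables (R : realType) (n k : nat) (zeta : R[i]).
Hypothesis zeta_prim : k.-primitive_root zeta.
Local Notation fock := (seq 'I_n -> R[i]^o).
Variables (j : nat) (jk : (j < k)%N).
Local Notation sector := (sector n zeta (zeta ^+ j)).
Implicit Types (v : sector) (a : k.-tuple 'I_n) (mu : seq 'I_n).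

Let k0 : (0 < k)%N := prim_order_gt0 zeta_prim.

Lemma sector_size mu : zeta ^+ size mu = zeta ^+ j -> (size mu %% k = j)%N.
Proof.
by move=> /eqP; rewrite (eq_prim_root_expr zeta_prim) [(j %% k)%N]modn_small //
  => /eqP.
Qed.

(** Among words shorter than [k], those of length [j] are the only ones in this sector, as [j < k];
    these coordinates are what the tails leave out. *)
Definition head_part v : {ffun j.-tuple 'I_n -> R[i]^o} := [ffun b =>
  (v : fock) (val b)].

Lemma head_part_linear : linear head_part.
Proof. by move=> c u v; apply/ffunP => b; rewrite !ffunE. Qed.

Lemma tail_partP a v : (fun mu => (v : fock) (mu ++ a)) \in in_sector zeta
  (zeta ^+ j).
Proof.
have [[C HC] v0] := sector_valP v; apply/in_sectorP; split.
  exists C => l; apply: le_trans (HC (k + l)%N).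
  rewrite /nrm2 [leRHS]big_split_ord /= -[leLHS]add0r lerD //.
    by apply: sumr_ge0 => m _; apply: wsum_ge0 => mu; exact: sqc_ge0.
  apply: ler_sum => m _; rewrite addnC wsum_cat.
  have := wsum_ge_term (g := fun al => wsum m (fun mu =>
    sqc ((v : fock) (mu ++ al)))) a.
  rewrite size_tuple; apply => al; apply: wsum_ge0 => mu; exact: sqc_ge0.
move=> mu zc; apply: v0; rewrite size_cat size_tuple exprD.
by rewrite (prim_expr_order zeta_prim) mulr1.
Qed.

Definition tail_part a v : sector := Sector (tail_partP a v).

Lemma tail_part_linear a : linear (tail_part a).
Proof. by move=> c u v; apply: sector_eqP. Qed.

Lemma size_drop_sub mu : (k <= size mu)%N -> size (drop (size mu - k) mu) == k.
Proof. by move=> kmu; rewrite size_drop subKn. Qed.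

Lemma split_injective v : head_part v = 0 -> (forall a, tail_part a v = 0) ->
  v = 0.
Proof.
move=> /ffunP hv tv; apply: sector_eqP => mu.
have [muk|kmu] := ltnP (size mu) k.
  have [_ v0] := sector_valP v.
  have [zj|/v0 //] := pselect (zeta ^+ size mu = zeta ^+ j).
  have muj : size mu == j by rewrite -(sector_size zj) modn_small.
  by have := hv (Tuple muj); rewrite !ffunE.
have := congr1 (fun u : sector => (u : fock) (take (size mu - k) mu))
  (tv (Tuple (size_drop_sub kmu))).
by rewrite /= cat_take_drop.
Qed.

(** The inverse of the splitting; short words of length other than [j] get 0, as membership in the
    sector demands. *)
Definition join_fun (x : {ffun j.-tuple 'I_n -> R[i]^o}) (vs : k.-tuple 'I_n ->
  sector) :
    fock := fun mu =>
  if (size mu < k)%N then if insub mu is Some b then x b else 0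
  else if insub (drop (size mu - k) mu) is Some a
       then (vs a : fock) (take (size mu - k) mu) else 0.

Lemma join_fun_tail x vs a mu : join_fun x vs (mu ++ a) = vs a mu.
Proof.
rewrite /join_fun size_cat size_tuple ltnNge leq_addl /= addnK.
by rewrite drop_size_cat // take_size_cat // valK.
Qed.

Lemma join_funP x vs : join_fun x vs \in in_sector zeta (zeta ^+ j).
Proof.
apply/in_sectorP; split; last first.
  move=> mu zj; rewrite /join_fun; case: ifP => muk.
    by case: insubP => // b /eqP muj _; case: zj; rewrite muj.
  case: insubP => // a _ aE; have [_ v0] := sector_valP (vs a).
  apply: v0 => H; apply: zj; rewrite -H size_takel ?leq_subr //.
  have kmu : (k <= size mu)%N by rewrite leqNgt muk.
  by rewrite -[in LHS](subnK kmu) exprD (prim_expr_order zeta_prim) mulr1.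
(* Bounds are chosen for all sequences at once; those of length other than [k] never enter the sum,
   so 0 serves for them. *)
have bound (al : seq 'I_n) : exists C : R, size al = k ->
    forall l, nrm2 l (fun mu => join_fun x vs (mu ++ al)) <= C.
  have [alk|/eqP alk] := eqVneq (size al) k; last by exists 0.
  have alk' : size al == k by rewrite alk.
  have [[C HC] _] := sector_valP (vs (Tuple alk')).
  exists C => _ l; rewrite (nrm2_eq (eta := vs (Tuple alk'))) // => mu _.
  by rewrite -(join_fun_tail x vs (Tuple alk')).
have [C HC] := choice bound.
exists (nrm2 k (join_fun x vs) + wsum k C) => l.
apply: le_trans (nrm2_mono _ (leq_addl k l)) _.
rewrite {1}/nrm2 big_split_ord /= lerD2l.
have -> : \sum_(i < l) wsum (k + i) (fun mu => sqc (join_fun x vs mu)) =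
    wsum k (fun al => nrm2 l (fun mu => join_fun x vs (mu ++ al))).
  rewrite wsum_sum; apply: eq_bigr => m _; rewrite addnC; exact: wsum_cat.
by apply: wsum_le => al alk; exact: HC.
Qed.

Lemma split_surjective x (vs : k.-tuple 'I_n -> sector) :
  exists v, head_part v = x /\ forall a, tail_part a v = vs a.
Proof.
exists (Sector (join_funP x vs)); split.
  apply/ffunP => b; rewrite ffunE /= /join_fun size_tuple jk.
  by rewrite valK.
by move=> a; apply: sector_eqP => mu /=; rewrite join_fun_tail.
Qed.

End Splitting.

(** * Homogeneous elements are not invertible *)

Section HomogeneousUnit.
Variables (R : realType) (A : cstarAlgType R) (n k : nat) (S : 'I_n -> A).
Hypothesis relS : cuntz_relations S.
Hypothesis genS : cstar_generated S.
Variable gamma : R[i] -> {lrmorphism A -> A}.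
Hypothesis gammaS : is_gauge_action S gamma.
Local Notation fock := (seq 'I_n -> R[i]^o).
Implicit Types (p q : ncpoly R n).

Definition defect p q : ncpoly R n := ncmul q p ++ [:: (-1, [::])].

Lemma ev_defect p q : ev S (defect p q) = ev S q * ev S p - 1.
Proof.
by rewrite ev_cat ev_mul /ev big_seq1 /= /ev_word big_nil scaleN1r.
Qed.

Lemma ncdeg_scale c p : ncdeg (ncscale c p) = ncdeg p.
Proof. by rewrite /ncdeg big_map. Qed.

(** Apply the contraction estimate to [4 p]; the factor 4 is squared by [nrm2]. *)
Lemma fock_poly_small (i : 'I_n) p D : (ncdeg p <= D)%N -> nm (ev S p) < 4^-1 ->
  forall l (xi : fock), supported D l xi ->
    nrm2 (l + D) (fock_poly p xi) <= 16^-1 * nrm2 l xi.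
Proof.
move=> pD p4 l xi sxi.
have := @fock_poly_le _ _ _ _ relS gamma gammaS genS i (ncscale 4 p) D l xi.
rewrite ncdeg_scale ev_scale => /(_ pD sxi).
have four : (4 : R[i]) = (4 : R)%:C by rewrite -(rmorph_nat (real_complex R)).
rewrite [X in nm (X *: _)]four nmZR ger0_norm // fock_poly_scale nrm2Z.
have -> : sqc (4 : R[i]) = 16 by rewrite four /sqc /= expr0n addr0 expr2; lra.
have p1 : 4 * nm (ev S p) < 1 by lra.
by move=> /(_ p1); lra.
Qed.

Lemma index_arith N m a b : (1 < m < N)%N ->
  (a + (N * b + 1) = N * a + m + b)%N -> False.
Proof.
move=> /andP[m1 mN]; have [ba|ab] := leqP b a.
  have := leq_mul2l N.-1 b a; nia.
have : (N.-1 * a.+1 <= N.-1 * b)%N by rewrite leq_mul2l ab orbT.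
nia.
Qed.

Lemma homogeneous_not_invertible (zeta : R[i]) (hn : (2 <= n)%N) (hk : (2 <= k)%N)
    (zeta_prim : k.-primitive_root zeta) (v b : A) :
  gamma zeta v = zeta *: v -> b * v = 1 -> v * b = 1 -> False.
Proof.
move=> gv bv vb; have k0 : (0 < k)%N by apply: leq_trans hk.
have z1 : `|zeta| = 1 := unity_norm k0 (prim_expr_order zeta_prim).
have z0 : zeta != 0 by rewrite -normr_eq0 z1 oner_eq0.
have [gstar gS] := gammaS z1.
have gb : gamma zeta b = zeta^-1 *: b.
  have : gamma zeta (v * b) = 1 by rewrite vb rmorph1.
  rewrite rmorphM /= gv -scalerAl => H.
  rewrite -[LHS]mul1r -bv -mulrA -[v * _](scalerK z0) H -scalerAr mulr1 //.
have zk1 : zeta^-1 ^+ k = 1 by rewrite exprVn (prim_expr_order zeta_prim) invr1.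
have nb0 : 0 < nm b + 1 by rewrite ltr_wpDl ?nm_ge0.
(* Each of the two error terms in [q p - 1] and in [p q - 1] is to be at most 1/16, for a total of
   1/8, below the threshold 1/4. The tolerance for [q] involves the norm of [p], so [p] is chosen
   before [q]. *)
have [|p [pd vp]] := homogeneous_approx genS zeta_prim gstar gS
  (prim_expr_order zeta_prim) gv (e := 16^-1 / (nm b + 1)).
  by rewrite divr_gt0.
have np0 : 0 < nm (ev S p) + 1 by rewrite ltr_wpDl ?nm_ge0.
have [|q [qd bq]] := homogeneous_approx genS zeta_prim gstar gS
  zk1 gb (e := 16^-1 / (nm (ev S p) + 1)).
  by rewrite divr_gt0.
have close (x y : A) (c : R) : 0 < c -> nm x <= 16^-1 / c -> nm y + 1 <= c ->
  nm x * nm y <= 16^-1.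
  move=> c0; rewrite ler_pdivlMr // => H yc; apply: le_trans H.
  by rewrite ler_wpM2l ?nm_ge0 //; lra.
have vpb := close _ _ _ nb0 vp (lexx _).
have bqp := close _ _ _ np0 bq (lexx _).
have y1 : nm (ev S (defect p q)) < 4^-1.
  have -> : ev S (defect p q) = - ((b - ev S q) * ev S p + b * (v - ev S p)).
    by rewrite ev_defect mulrBl mulrBr bv [in RHS]addrC addrA subrK opprB.
  rewrite nmN; apply: (le_lt_trans (nmD _ _)).
  have := nmM (b - ev S q) (ev S p); have := nmM b (v - ev S p).
  rewrite [nm b * _]mulrC; lra.
have y2 : nm (ev S (defect q p)) < 4^-1.
  have -> : ev S (defect q p) = - ((v - ev S p) * b + ev S p * (b - ev S q)).
    by rewrite ev_defect mulrBl mulrBr vb addrA subrK opprB.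
  rewrite nmN; apply: (le_lt_trans (nmD _ _)).
  have := nmM (ev S p) (b - ev S q); have := nmM (v - ev S p) b.
  rewrite [nm (ev S p) * _]mulrC; lra.
(* The first two summands serve kernel and range; [ncdeg p] is there so that [p] commutes with the
   splitting on words of length at least [D]. *)
pose D := (ncdeg (defect p q) + ncdeg (defect q p) + ncdeg p)%N.
have D1 : (ncdeg (defect p q) <= D)%N by rewrite /D; lia.
have D2 : (ncdeg (defect q p) <= D)%N by rewrite /D; lia.
have Dp : (ncdeg p <= D)%N by rewrite /D; lia.
have i0 : 'I_n := Ordinal (ltnW hn).
have small1 := fock_poly_small i0 D1 y1.
have small2 := fock_poly_small i0 D2 y2.
pose V := sector n zeta (zeta ^+ 0); pose W := sector n zeta (zeta ^+ 1).
have fP (u : V) : fock_poly p u \in in_sector zeta (zeta ^+ 1).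
  have -> : zeta ^+ 1 = zeta * zeta ^+ 0 by rewrite expr0 mulr1 expr1.
  exact: sector_polyP.
have gP (w : W) : fock_poly q w \in in_sector zeta (zeta ^+ 0).
  have -> : zeta ^+ 0 = zeta^-1 * zeta ^+ 1 by rewrite expr0 expr1 mulVf.
  exact: sector_polyP.
have wd t : t \in defect q p -> weight zeta t.2 = 1.
  rewrite mem_cat inE => /orP[/allpairsP [[s u] /= [sp uq ->]]|/eqP ->] /=.
    by rewrite /weight big_cat /= -/(weight zeta s.2) (pd _ sp) -/(weight zeta
      u.2) (qd _ uq) divff.
  by rewrite /weight big_nil.
have eP (x : {ffun D.-bseq 'I_n -> R[i]^o}) :
    fock_poly (defect q p) (sector_ext zeta (zeta ^+ 1) x) \in in_sector zeta
      (zeta ^+ 1).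
  by rewrite -[X in in_sector _ X]mul1r; exact: sector_polyP.
pose f (u : V) : W := Sector (fP u).
pose e (x : {ffun D.-bseq 'I_n -> R[i]^o}) : W := - Sector (eP x).
have lf : linear f.
  by move=> a u u'; apply: sector_eqP => mu; rewrite /= fock_poly_linear.
have le : linear e.
  move=> a x x'; rewrite /e scalerN -opprD; congr (- _);
    apply: sector_eqP => mu /=.
  have -> : sector_ext_fun zeta (zeta ^+ 1) (a *: x + x') =
    a *: sector_ext_fun zeta (zeta ^+ 1) x + sector_ext_fun zeta (zeta ^+ 1) x'.
    exact: (congr1 (@sector_val _ _ _ _) (sector_ext_linear zeta (zeta ^+ 1) a
      x x')).
  by rewrite fock_poly_linear.
have injf u : f u = 0 -> sector_low D u = 0 -> u = 0.
  move=> fu; apply: (sector_poly_injective D1 small1).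
  exact: (congr1 (@sector_val _ _ _ _) fu).
(* The roles of [p] and [q] are exchanged: [w] is [p (q w')] up to the defect of [p q], which is
   evaluated on a finite-dimensional space. *)
have surjf w : exists u x, w = f u + e x.
  have [w' [x wE]] := sector_poly_surjective z1 qd pd (divff z0) D2 small2 w.
  exists (Sector (gP w')), x; apply: val_inj; exact: wE.
(* At words of length at least [D], applying [p] and fixing the last [k] letters commute, so each
   difference is recovered from its coordinates on shorter words. *)
have fr : finite_rank (fun u : V => [ffun a : k.-tuple 'I_n =>
    tail_part zeta_prim a (f u) - f (tail_part zeta_prim a u)]).
  exists {ffun k.-tuple 'I_n -> {ffun D.-bseq 'I_n -> R[i]^o}},
    (fun u => [ffun a => sector_low D
       (tail_part zeta_prim a (f u) - f (tail_part zeta_prim a u))]),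
    (fun x : {ffun k.-tuple 'I_n -> {ffun D.-bseq 'I_n -> R[i]^o}} =>
       [ffun a => sector_ext zeta (zeta ^+ 1) (x a)]).
  split=> [c u u'|c x x'|u]; apply/ffunP => a; rewrite !ffunE.
  - rewrite lf !tail_part_linear lf -sector_low_linear; congr sector_low.
    by rewrite opprD scalerBr addrACA.
  - by rewrite sector_ext_linear.
  - set w := _ - _; apply: sector_eqP => mu.
    have [muD|Dmu] := ltnP (size mu) D; first by rewrite sector_ext_low.
    rewrite /= /sector_ext_fun ltnNge Dmu /=; apply/eqP; rewrite subr_eq0;
      apply/eqP.
    by rewrite /= fock_poly_rcat // (leq_trans Dp).
have := @self_similar_index _ V W f (k.-tuple 'I_n) _ _ _ _
  (@head_part R n zeta 0) (@tail_part R n k zeta zeta_prim 0)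
  (@head_part R n zeta 1) (@tail_part R n k zeta zeta_prim 1)
  (sector_low D) e lf (@head_part_linear R n zeta 0)
  (@tail_part_linear R n k zeta zeta_prim 0) (@head_part_linear R n zeta 1)
  (@tail_part_linear R n k zeta zeta_prim 1)
  (@split_injective R n k zeta zeta_prim 0 k0) (split_surjective zeta_prim k0)
  (@split_injective R n k zeta zeta_prim 1 hk) (split_surjective zeta_prim hk)
  fr (@sector_low_linear R n zeta _ D) le injf surjf.
have dim_head j : dim {ffun j.-tuple 'I_n -> R[i]^o} = (n ^ j)%N.
  by rewrite -[LHS]/(#|{: j.-tuple 'I_n}| * 1)%N card_tuple card_ord muln1.
move=> [P [Q]]; rewrite !dim_head expn0 expn1 card_tuple card_ord.
apply: index_arith; rewrite hn /=.
by rewrite -[X in (X < _)%N]expn1 ltn_exp2l.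
Qed.

End HomogeneousUnit.

(** * Weak local-triviality dimension *)

Section Cone.
Variable R : realType.

Lemma id_halfopen01_C0 : C0_halfopen01 (@id_halfopen01 R).
Proof.
have near_cont (x : R) (e : R[i]) : 0 < e ->
    exists2 d : R, 0 < d & forall y, `|x - y| < d ->
      `|x%:C - y%:C : R[i]^o| < e.
  move=> e0; have eE : e = (complex.Re e)%:C by rewrite RRe_real // gtr0_real.
  exists (complex.Re e); first by move: e0; rewrite {1}eE ltcR.
  move=> y xy; rewrite -rmorphB [ltRHS]eE normc_def /= expr0n addr0 sqrtr_sqr
    ltcR.
  by [].
have cont : continuous (fun x : R => x%:C : R[i]^o).
  move=> x; apply/cvgrPdist_lt => e e0; have [d d0 xd] := near_cont x e e0.
  near=> y; apply: xd; near: y.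
  by apply: cvgr_dist_lt.
split.
- apply: (@subspace_eq_continuous _ _ _ (fun x : R => x%:C : R[i]^o)).
    by move=> x xA; rewrite -[RHS]/(id_halfopen01 x) /id_halfopen01 /patch xA.
  exact: continuous_subspaceT.
- apply/cvgrPdist_lt => e e0; have [d d0 xd] := near_cont 0 e e0.
  near=> y; rewrite /id_halfopen01 /patch; case: ifP => _;
    last by rewrite subrr normr0.
  apply: xd; near: y; apply: cvgr_dist_lt => //.
  exact: cvg_at_right_filter.
- by move=> x xA; rewrite /id_halfopen01 /patch memNset.
Unshelve. all: by end_near. Qed.

Lemma elem_tensor_in_cone (G : finGroupType) (u : G -> R[i]^o) :
  elem_tensor (@id_halfopen01 R) u \in @cone_tensor R G.
Proof.
apply/mem_set => e e0; exists (elem_tensor (@id_halfopen01 R) u).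
  exists 1%N, (fun=> @id_halfopen01 R), (fun=> u); split; first by move=> _;
    exact: id_halfopen01_C0.
  by rewrite big_ord1.
by move=> p; rewrite subrr normr0 lecR ltW.
Qed.

End Cone.

(** With [chi] the character sending [g] to [zeta ^+ g], the product of [t] tensor [chi] and [t]
    tensor its inverse is the square of [H], whose image is invertible. So the image of [t] tensor
    [chi] is invertible, and equivariance makes it a gauge eigenvector for [zeta]. *)
Lemma no_wlt_witness0 (R : realType) (n k : nat) (hn : (2 <= n)%N) (hk : (2 <= k)%N)
  (O : cstarAlgType R) (S : 'I_n -> O) (hO : is_cuntz_algebra S)
  (gamma : R[i] -> {lrmorphism O -> O}) (hgamma : is_gauge_action S gamma)
  (zeta : R[i]) (hzeta : k.-primitive_root zeta) :
  ~ wlt_witness (fun (g : 'Z_k) (a : O) => gamma (zeta ^+ g)%R a) 0.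
Proof.
move=> [rho [rhoP [c]]]; rewrite big_ord1; set H := elem_tensor _ _ => -[cH Hc].
have [[_ rhoZ rhoM _] equiv] := rhoP ord0;
  set r := rho ord0 in rhoZ rhoM equiv cH Hc.
have z0 : zeta != 0.
  by rewrite -normr_eq0 (unity_norm (prim_order_gt0 hzeta) (prim_expr_order
    hzeta)) oner_eq0.
pose t := @id_halfopen01 R.
pose chi (x : 'Z_k) : R[i]^o := zeta ^+ x;
  pose chi' (x : 'Z_k) : R[i]^o := (zeta ^+ x)^-1.
pose F := elem_tensor t chi; pose F' := elem_tensor t chi'.
have FF' : F * F' = H * H.
  apply/funext => -[s x]; rewrite !fctE /F /F' /H /elem_tensor /= mulrACA
    !mulr1.
  by rewrite /chi /chi' divff ?mulr1 // expf_neq0.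
have inC u : elem_tensor t u \in @cone_tensor R 'Z_k := elem_tensor_in_cone u.
have vw : r F * r F' = r H * r H by rewrite -!rhoM ?FF' ?inC.
have wv : r F' * r F = r H * r H.
  by rewrite -!rhoM ?inC // -FF'; congr r; apply/funext => p;
    rewrite !fctE mulrC.
have gF : gamma zeta (r F) = zeta *: r F.
  pose one : 'Z_k := 1%R.
  (* The modulus built into ['Z_k] is [(Zp_trunc k).+2], which equals [k] because [2 <= k]. *)
  have modZ m : (m %% (Zp_trunc k).+2 = m %% k)%N by rewrite Zp_cast.
  have := equiv one F (inC chi); rewrite expr1 => <-.
  have -> : translate one F = zeta *: F.
    apply/funext => -[s x]; rewrite !fctE /translate /F /elem_tensor /= /chi.
    have -> : zeta ^+ (x * one)%g = zeta * zeta ^+ x.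
      rewrite -exprS -[((x * one)%g : nat)]/((x + one) %% (Zp_trunc k).+2)%N.
      by rewrite modZ (prim_expr_mod hzeta) addn1.
    exact: mulrCA.
  exact: rhoZ _ _ (inC chi).
have vb : r F * (r F' * c * c) = 1.
  by rewrite !mulrA vw -[r H * r H * c]mulrA Hc mulr1.
(* The right inverse [r F' * c * c] has its factors in another order; the existence of a left
   inverse shows that it is two-sided. *)
have left_inv : (c * c * r F') * r F = 1.
  by rewrite -mulrA wv mulrA -[c * c * r H]mulrA cH mulr1.
have bv : (r F' * c * c) * r F = 1.
  by rewrite -[r F' * c * c]mul1r -left_inv -[_ * r F * _]mulrA vb mulr1.
have [relS genS _] := hO.
exact: (homogeneous_not_invertible relS genS hgamma hn hk hzeta gF bv vb).
Qed.

Theorem theorem5p3 (R : realType) (n k : nat) (hn : (2 <= n)%N) (hk : (2 <= k)%N)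
  (O : cstarAlgType R) (S : 'I_n -> O) (hO : is_cuntz_algebra S)
  (gamma : R[i] -> {lrmorphism O -> O}) (hgamma : is_gauge_action S gamma)
  (zeta : R[i]) (hzeta : k.-primitive_root zeta) :
  (1%:E <= wlt_dim (fun (g : 'Z_k) (a : O) => gamma (zeta ^+ g)%R a))%E.
Proof.
rewrite /wlt_dim; case: pselect => [ex_m|_]; last exact: leey.
case: ex_minnP => -[|m] /asboolP wit _; last by rewrite lee_fin ler1n.
by case: (no_wlt_witness0 hn hk hO hgamma hzeta wit).
Qed.
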